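(* Let $G=(V,E)$ be a finite directed acyclic graph with $m$ edges, and let $G^{r}$ be its reduced graph as defined in the context. Let $s$ and $t$ be the number of sources (vertices of indegree $0$) and sinks (vertices of outdegree $0$) of $G^{r}$, respectively. Then it can be tested in $O(s\cdot t+m)$ time whether $G^{r}$ is singly-connected.
   Context: A directed graph (possibly with parallel edges) is singly-connected if for every ordered pair of vertices $v,w$ there is at most one simple path from $v$ to $w$; paths are regarded as sequences of edges, so two parallel edges from $v$ to $w$ give two distinct simple paths. Reduced graph: starting from the acyclic graph $G$, first process the vertices in bottom-up order with respect to the partial order given by $G$; whenever a vertex $v$ has indegree $1$, with unique incoming edge $(u,v)$, contract it into $u$: replace every edge $(v,w)$ by $(u,w)$ and delete $v$ and the edge $(u,v)$. Call the result $G'$. Then apply the symmetric procedure to $G'$ in top-down order, eliminating every vertex of outdegree $1$: if $v$ has a unique outgoing edge $(v,w)$, replace every edge $(u,v)$ by $(u,w)$ and delete $v$ and $(v,w)$. The resulting graph, which may contain parallel edges, is $G^{r}$. The time bound includes computing $G^r$ from $G$. *)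

(* Defs.v *)
From mathcomp Require Import all_boot.

Set Implicit Arguments.
Unset Strict Implicit.
Unset Printing Implicit Defensive.

(* Directed multigraphs. Vertices and edges are drawn from ambient finite types
   and the sets [verts] and [edges] say which ones are present, so that edges
   keep their identity when an endpoint is contracted. The values of [src] and
   [tgt] outside [edges] are irrelevant. *)
Record digraph (V E : finType) := Digraph {
  verts : {set V};
  edges : {set E};
  src : E -> V;
  tgt : E -> V
}.

Section Graphs.
Variables V E : finType.
Implicit Types (G H : digraph V E) (u v w : V) (e f : E) (p q : seq E).

Definition in_edges G v := [set e in edges G | tgt G e == v].
Definition out_edges G v := [set e in edges G | src G e == v].

Definition sources G := [set v in verts G | in_edges G v == set0].
Definition sinks G := [set v in verts G | out_edges G v == set0].

Fixpoint is_walk G v p w : bool :=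
  if p is e :: p' then
    [&& e \in edges G, src G e == v & is_walk G (tgt G e) p' w]
  else v == w.

Definition simple_path G v p w : bool :=
  is_walk G v p w && uniq (v :: map (tgt G) p).

Definition singly_connected G : Prop :=
  forall v w, v \in verts G -> w \in verts G ->
  forall p q, simple_path G v p w -> simple_path G v q w -> p = q.

Definition acyclic G : Prop :=
  forall v p, v \in verts G -> is_walk G v p v -> p = [::].

(* [unset1 A] is [Some e] when A = [set e] and [None] when A is not a
   singleton; vertices whose indegree (outdegree) is not 1 are kept. *)
Definition contract_in G v : digraph V E :=
  if unset1 (in_edges G v) is Some e then
    Digraph (verts G :\ v) (edges G :\ e)
            (fun f => if src G f == v then src G e else src G f) (tgt G)
  else G.

Definition contract_out G v : digraph V E :=
  if unset1 (out_edges G v) is Some e then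
    Digraph (verts G :\ v) (edges G :\ e)
            (src G) (fun f => if tgt G f == v then tgt G e else tgt G f)
  else G.

(* Edges point downwards: sources are at the top, sinks at the bottom. *)
Definition bottom_up G (o : seq V) : Prop :=
  perm_eq o (enum (verts G)) /\
  forall e, e \in edges G -> index (tgt G e) o < index (src G e) o.

Definition top_down G (o : seq V) : Prop :=
  perm_eq o (enum (verts G)) /\
  forall e, e \in edges G -> index (src G e) o < index (tgt G e) o.

Definition contract_all_in G (o : seq V) := foldl contract_in G o.
Definition contract_all_out G (o : seq V) := foldl contract_out G o.

Definition reduced G Gr : Prop :=
  exists o1 o2 : seq V,
    let G' := contract_all_in G o1 in
    [/\ bottom_up G o1, top_down G' o2 & Gr = contract_all_out G' o2].

(* An acyclic graph, all of whose edges have their endpoints in the vertex set,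
   does have a reduced graph. *)
Lemma reduced_exists G :
  (forall e, e \in edges G -> (src G e \in verts G) && (tgt G e \in verts G)) ->
  acyclic G -> exists Gr, reduced G Gr.
Proof.
move=> wfG acG.
pose r u v := [exists e in edges G, (src G e == u) && (tgt G e == v)].
pose below v := #|connect r v|.
have walk u v : connect r u v -> exists p, is_walk G u p v.
  case/connectP=> p; elim: p u => [|x p IHp] u /= => [_ ->|].
    by exists [::] => /=.
  case/andP=> /exists_inP[e Ee /andP[/eqP su /eqP tx]] /IHp {}IHp /IHp[q Wq].
  by exists (e :: q); rewrite /= Ee su eqxx tx Wq.
have below_lt e : e \in edges G -> below (tgt G e) < below (src G e).
  move=> Ee; have cst : connect r (src G e) (tgt G e).
    by apply: connect1; apply/exists_inP; exists e; rewrite ?eqxx.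
  apply: proper_card; apply/properP; split.
    by apply/subsetP=> x; rewrite !inE; apply: connect_trans.
  exists (src G e); rewrite !inE ?connect0 //; apply/negP=> /walk[p Wp].
  have /andP[sV _] := wfG e Ee.
  by have := acG (src G e) (e :: p) sV; rewrite /= Ee eqxx Wp => /(_ isT).
pose o := sort (relpre below leq) (enum (verts G)).
have po : perm_eq o (enum (verts G)) by rewrite perm_sort.
have tot : total (relpre below leq) by move=> x y; apply: leq_total.
have tr : transitive (relpre below leq) by move=> x y z; apply: leq_trans.
have up e : e \in edges G -> index (tgt G e) o < index (src G e) o.
  move=> Ee; have /andP[sV tV] := wfG e Ee; rewrite ltnNge; apply/negP=> le_st.
  have: below (src G e) <= below (tgt G e).
    apply: (sorted_leq_index tr _ (sort_sorted tot _)) le_st => //.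
    - by move=> x; apply: leqnn.
    - by rewrite mem_sort mem_enum.
    - by rewrite mem_sort mem_enum.
  by rewrite leqNgt below_lt.
pose inv H := (forall e, e \in edges H -> index (tgt H e) o < index (src H e) o)
  /\ (forall e, e \in edges H -> (src H e \in verts H) && (tgt H e \in verts H))
  /\ verts H \subset verts G.
have inv_step H v : inv H -> inv (contract_in H v).
  move=> [ltH [wfH subH]]; rewrite /contract_in.
  case Du: (unset1 _) => [e|//].
  have De: in_edges H v = [set e] by have := unset1K (in_edges H v); rewrite Du.
  have: e \in in_edges H v by rewrite De set11.
  rewrite inE => /andP[Ee /eqP te].
  have ltse: index v o < index (src H e) o by rewrite -te ltH.
  have nsv: src H e != v by apply: contraTneq ltse => ->; rewrite ltnn.
  split=> [f|]; last split=> [f|]; rewrite /= ?inE.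
  - case/andP=> _ Ef; case: ifP => [/eqP sf|_]; last exact: ltH.
    by apply: ltn_trans ltse; rewrite -sf ltH.
  - case/andP=> nfe Ef; have /andP[sV tV] := wfH f Ef.
    have ntv: tgt H f != v.
      apply: contraNneq nfe => tf.
      have: f \in in_edges H v by rewrite inE Ef tf eqxx.
      by rewrite De inE.
    rewrite ntv tV /= andbT; case: ifP => [_|->//].
    by rewrite nsv; have /andP[] := wfH e Ee.
  by apply: subset_trans subH; apply: subD1set.
have {inv_step} invG' s : inv (contract_all_in G s).
  rewrite /contract_all_in; have: inv G by [].
  by elim: s (G) => //= v s IHs H /inv_step/IHs.
set G' := contract_all_in G o.
have [lt' [wf' sub']] : inv G' by apply: invG'.
pose o2 := rev [seq v <- o | v \in verts G'].
exists (contract_all_out G' o2); exists o, o2; split=> //.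
have uo: uniq o by rewrite (perm_uniq po) enum_uniq.
have mo2 v : (v \in o2) = (v \in verts G').
  rewrite mem_rev mem_filter (perm_mem po) mem_enum.
  by apply: andb_idr => /(subsetP sub').
split.
  apply: uniq_perm => [||v]; last by rewrite mo2 mem_enum.
  - by rewrite rev_uniq filter_uniq.
  - exact: enum_uniq.
move=> e Ee; have /andP[sV tV] := wf' e Ee; have := lt' e Ee.
have rel_tr: transitive (relpre (index^~ o) ltn) by move=> x y z; apply: ltn_trans.
have so: sorted (relpre (index^~ o) ltn) o.
  apply/(sortedP (src G' e)) => i lt_i.
  by rewrite /= !index_uniq // ltnW.
have so2: sorted (fun y x => relpre (index^~ o) ltn x y) o2.
  by rewrite rev_sorted sorted_filter.
move=> lt_ts; rewrite ltnNge leq_eqVlt; apply/norP; split.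
  apply: contraTN lt_ts => /eqP eqi; rewrite -leqNgt.
  by rewrite -(nth_index (src G' e) (x:=src G' e) (s:=o2)) ?mo2 // -eqi nth_index ?mo2.
apply/negP=> lt_i.
have := sorted_ltn_index (fun y x z a b => rel_tr _ _ _ b a) so2.
move=> /(_ (tgt G' e) (src G' e)); rewrite !mo2 => /(_ tV sV lt_i) /=.
by rewrite ltnNge ltnW.
Qed.

End Graphs.

(* A word RAM with w-bit words (Cook-Reckhow instruction set, with the registers
   kept apart from the memory). Each instruction takes one step. Arithmetic is
   on naturals below 2 ^ w, with subtraction truncated at 0. *)
Inductive instr :=
| IConst (r c : nat)        (* R[r] := c *)
| IAdd (r a b : nat)        (* R[r] := R[a] + R[b] mod 2^w *)
| ISub (r a b : nat)        (* R[r] := max 0 (R[a] - R[b]) *)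
| ILoad (r a : nat)         (* R[r] := M[R[a]] *)
| IStore (a r : nat)        (* M[R[a]] := R[r] *)
| IJumpPos (r l : nat)      (* if R[r] > 0 goto l *)
| IHalt.

Record state := State { pc : nat; reg : nat -> nat; mem : nat -> nat }.

Definition upd (f : nat -> nat) (a x : nat) : nat -> nat :=
  fun b => if b == a then x else f b.

(* Running past the end of the program halts. *)
Definition fetch (P : seq instr) (s : state) : instr := nth IHalt P (pc s).

Definition step (w : nat) (P : seq instr) (s : state) : state :=
  let: State i R M := s in
  match fetch P s with
  | IConst r c => State i.+1 (upd R r (c %% 2 ^ w)) M
  | IAdd r a b => State i.+1 (upd R r ((R a + R b) %% 2 ^ w)) M
  | ISub r a b => State i.+1 (upd R r (R a - R b)) M
  | ILoad r a => State i.+1 (upd R r (M (R a))) M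
  | IStore a r => State i.+1 R (upd M (R a) (R r))
  | IJumpPos r l => State (if 0 < R r then l else i.+1) R M
  | IHalt => s
  end.

Definition halted (P : seq instr) (s : state) : Prop := fetch P s = IHalt.

Definition init (input : seq nat) : state :=
  State 0 (fun=> 0) (fun a => nth 0 input a).

(* On the given input, P halts after at most T steps with x in register 0. *)
Definition outputs_within (w : nat) (P : seq instr) (input : seq nat)
    (T x : nat) : Prop :=
  exists k, let s := iter k (step w P) (init input) in
    [/\ k <= T, halted P s & reg s 0 = x].

Section Input.
Variables n m : nat.

(* Every finite multigraph with n vertices and m edges, up to renaming. *)
Definition input_graph (a b : 'I_m -> 'I_n) : digraph 'I_n 'I_m :=
  Digraph setT setT a b.

(* n, m, then the two endpoints of each edge, in the given (arbitrary) order. *)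
Definition encode (a b : 'I_m -> 'I_n) : seq nat :=
  [:: n, m & flatten [seq [:: val (a e); val (b e)] | e <- enum 'I_m]].

(* c * log (n + m) bits, up to rounding. *)
Definition word_length (c : nat) : nat := c * up_log 2 (n + m + 2).

End Input.

(* Main.v *)
Require Import Defs.
From mathcomp Require Import all_boot zify.

Set Implicit Arguments.
Unset Strict Implicit.
Unset Printing Implicit Defensive.

(* Contracting a vertex of indegree 1 leaves the set of edges entering every other
   vertex unchanged, so the first pass depends only on the indegrees in G: it keeps
   the vertices of indegree other than 1 and the edges entering them, and moves the
   source of an edge up along unique incoming edges until it meets a kept vertex.
   The second pass is the same operation on the reversed graph. Hence the reduced
   graph is computed in time O(n + m), and in it every non-sink has outdegree at
   least 2.

   An acyclic graph is singly-connected iff, for each source r, distinct edges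
   leaving vertices reachable from r have distinct targets. A breadth-first search
   from r, stopped at the first vertex met twice, tests this. A search that is not
   stopped explores an out-tree whose inner vertices have at least two children and
   whose leaves are sinks, so it visits at most 2 t vertices; the only search that
   is stopped costs O(n). As isolated vertices of G are both sources and sinks of
   the reduced graph, n <= 2 m + s t.

   The program is written in a small imperative language with variables and arrays,
   whose semantics counts steps and which compiles to the RAM. *)

(** * An imperative language compiled to the RAM *)

Inductive cmd :=
| CSkip
| CConst (x c : nat)
| CAdd (x y z : nat)
| CSub (x y z : nat)
| CInp (x y : nat)
| CGet (x j y : nat)
| CPut (j y x : nat)
| CSeq (c d : cmd)
| CIf (x : nat) (c d : cmd)
| CWhile (x : nat) (c : cmd).

Record hst := HSt { var : nat -> nat; arr : nat -> nat -> nat; clk : nat }.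

(* [eqn] rather than [==], so that [simpl] computes lookups at numerals. *)
Definition setf T (f : nat -> T) (a : nat) (x : T) (b : nat) :=
  if eqn b a then x else f b.

Lemma setfE T (f : nat -> T) a x b : setf f a x b = if b == a then x else f b.
Proof. by rewrite /setf eqnE. Qed.

Definition assign s x v := HSt (setf (var s) x v) (arr s) (clk s).+1.
Definition store s j i v :=
  HSt (var s) (setf (arr s) j (upd (arr s j) i v)) (clk s).+1.
Definition tick s := HSt (var s) (arr s) (clk s).+1.

(** * Step-counting semantics and total-correctness logic *)

Section Semantics.
Variables (L B : nat) (inp : nat -> nat).

(** The bounds in the rules make a command stuck whenever its compiled form could wrap modulo [B] or
    address a cell outside its array. An execution therefore certifies that neither happens. *)
Inductive exec : cmd -> hst -> hst -> Prop :=
| ESkip s : exec CSkip s s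
| EConst s x c : c < B -> exec (CConst x c) s (assign s x c)
| EAdd s x y z : var s y + var s z < B ->
    exec (CAdd x y z) s (assign s x (var s y + var s z))
| ESub s x y z : exec (CSub x y z) s (assign s x (var s y - var s z))
| EInp s x y : var s y < L.*2 -> exec (CInp x y) s (assign s x (inp (var s y)))
| EGet s x j y : j < 16 -> var s y < L ->
    exec (CGet x j y) s (assign s x (arr s j (var s y)))
| EPut s j y x : j < 16 -> var s y < L ->
    exec (CPut j y x) s (store s j (var s y) (var s x))
| ESeq s1 s2 s3 c d : exec c s1 s2 -> exec d s2 s3 -> exec (CSeq c d) s1 s3
| EIfT s s' x c d : 0 < var s x -> exec c (tick s) s' -> exec (CIf x c d) s s'
| EIfF s s' x c d : var s x = 0 -> exec d (tick s) s' -> exec (CIf x c d) s s'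
| EWhileT s1 s2 s3 x c : 0 < var s1 x -> exec c (tick s1) s2 ->
    exec (CWhile x c) s2 s3 -> exec (CWhile x c) s1 s3
| EWhileF s x c : var s x = 0 -> exec (CWhile x c) s (tick s).

Lemma exec_clk c s s' : exec c s s' -> clk s <= clk s'.
Proof. by elim=> //= *; lia. Qed.

Definition wp c (Q : hst -> Prop) s := exists2 s', exec c s s' & Q s'.

Fixpoint vars_of c : seq nat :=
  match c with
  | CConst x _ | CAdd x _ _ | CSub x _ _ | CInp x _ | CGet x _ _ => [:: x]
  | CSeq c d | CIf _ c d => vars_of c ++ vars_of d
  | CWhile _ c => vars_of c
  | _ => [::]
  end.

Fixpoint arrs_of c : seq nat :=
  match c with
  | CPut j _ _ => [:: j]
  | CSeq c d | CIf _ c d => arrs_of c ++ arrs_of d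
  | CWhile _ c => arrs_of c
  | _ => [::]
  end.

Definition frame c s s' :=
  (forall x, x \notin vars_of c -> var s' x = var s x) /\
  (forall j, j \notin arrs_of c -> arr s' j = arr s j).

Lemma exec_frame c s s' : exec c s s' -> frame c s s'.
Proof.
elim=> {c s s'} /=; try by move=> *; split=> //= ?; rewrite inE ?setfE => /negPf->.
- by move=> s1 s2 s3 c d _ [v1 a1] _ [v2 a2]; split=> x;
    rewrite mem_cat negb_or => /andP[n1 n2]; rewrite ?v2 ?v1 ?a2 ?a1.
- by move=> s s' x c d _ _ [v1 a1]; split=> y;
    rewrite mem_cat negb_or => /andP[n1 n2]; rewrite ?v1 ?a1.
- by move=> s s' x c d _ _ [v1 a1]; split=> y;
    rewrite mem_cat negb_or => /andP[n1 n2]; rewrite ?v1 ?a1.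
- by move=> s1 s2 s3 x c _ _ [v1 a1] _ [v2 a2]; split=> y ny;
    rewrite ?v2 ?v1 ?a2 ?a1.
Qed.

(** The frame comes for free from the syntax of [c], so specifications need not mention the
    variables and arrays that [c] does not write. *)
Lemma wp_conseq c (Q Q' : hst -> Prop) s :
  wp c Q s -> (forall s', frame c s s' -> Q s' -> Q' s') -> wp c Q' s.
Proof. by case=> s' E q H; exists s' => //; apply: H (exec_frame E) q. Qed.

(** Computes through straight-line code and conditionals by simplification, and stops at a loop,
    where [wp] remains to be shown by a loop rule. *)
Fixpoint vc c (Q : hst -> Prop) s : Prop :=
  match c with
  | CSkip => Q s
  | CConst x k => k < B /\ Q (assign s x k)
  | CAdd x y z => var s y + var s z < B /\ Q (assign s x (var s y + var s z))
  | CSub x y z => Q (assign s x (var s y - var s z))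
  | CInp x y => var s y < L.*2 /\ Q (assign s x (inp (var s y)))
  | CGet x j y => [/\ j < 16, var s y < L & Q (assign s x (arr s j (var s y)))]
  | CPut j y x =>
      [/\ j < 16, var s y < L & Q (store s j (var s y) (var s x))]
  | CSeq c d => vc c (vc d Q) s
  | CIf x c d => (0 < var s x -> vc c Q (tick s)) /\
                 (var s x = 0 -> vc d Q (tick s))
  | CWhile _ _ => wp c Q s
  end.

Lemma vc_wp c Q s : vc c Q s -> wp c Q s.
Proof.
elim: c Q s => //=.
- by move=> Q s; exists s => //; constructor.
- by move=> x k Q s [? ?]; exists (assign s x k) => //; constructor.
- by move=> x y z Q s [? ?]; eexists; [constructor|].
- by move=> x y z Q s ?; eexists; [constructor|].
- by move=> x y Q s [? ?]; eexists; [constructor|].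
- by move=> x j y Q s [? ? ?]; eexists; [constructor|].
- by move=> x j y Q s [? ? ?]; eexists; [constructor|].
- move=> c IHc d IHd Q s /IHc[s1 E1 /IHd[s2 E2 q]].
  by exists s2 => //; apply: ESeq E1 E2.
- move=> x c IHc d IHd Q s [H1 H2].
  case: (posnP (var s x)) => [z|p].
    by have [s' E q] := IHd _ _ (H2 z); exists s' => //; apply: EIfF.
  by have [s' E q] := IHc _ _ (H1 p); exists s' => //; apply: EIfT.
Qed.

Lemma wp_vc c Q s : wp c Q s -> vc c Q s.
Proof.
elim: c Q s => //=; try by move=> *; match goal with H : wp _ _ _ |- _ =>
  case: H => ? E; inversion E; subst end.
- move=> c IHc d IHd Q s [s' E q]; inversion E; subst.
  by apply: IHc; exists s2 => //; apply: IHd; exists s'.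
- move=> x c IHc d IHd Q s [s' E q]; inversion E; subst; split; try lia.
    by move=> _; apply: IHc; exists s'.
  by move=> _; apply: IHd; exists s'.
Qed.

Lemma wp_seq c d Q s : wp c (fun s' => wp d Q s') s -> wp (CSeq c d) Q s.
Proof. by case=> s1 E1 [s2 E2 q]; exists s2 => //; apply: ESeq E1 E2. Qed.

Lemma wp_if x c d Q s :
  (0 < var s x -> wp c Q (tick s)) -> (var s x = 0 -> wp d Q (tick s)) ->
  wp (CIf x c d) Q s.
Proof.
by move=> Hc Hd; apply: vc_wp; split=> h; apply: wp_vc; [apply: Hc | apply: Hd].
Qed.

(** Every iteration ticks the clock and the invariant keeps the clock below [T], so the time bound
    doubles as the termination argument: the induction is on [T - clk]. *)
Lemma wp_while (Inv : hst -> Prop) T x c (Q : hst -> Prop) s :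
  Inv s ->
  (forall s', Inv s' -> clk s' <= T) ->
  (forall s', frame c s s' -> Inv s' -> 0 < var s' x -> wp c Inv (tick s')) ->
  (forall s', frame c s s' -> Inv s' -> var s' x = 0 -> Q (tick s')) ->
  wp (CWhile x c) Q s.
Proof.
move=> I0 IT Ib Ie.
suff H k s1 : T - clk s1 < k -> Inv s1 -> frame c s s1 ->
    wp (CWhile x c) Q s1 by apply: (H (T - clk s).+1).
elim: k s1 => // k IHk s1 le_k I1 F1.
case: (posnP (var s1 x)) => [z|p].
  by exists (tick s1); [apply: EWhileF | apply: Ie].
have [s2 E2 I2] := Ib _ F1 I1 p.
have le12 := exec_clk E2; have F2 := exec_frame E2; have := IT _ I2.
have := IT _ I1 => /= T1 T2; rewrite /= in le12.
case: (IHk s2) => [|||s3 E3 q] //; first by lia.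
  case: F1 F2 => v1 a1 [v2 a2].
  by split=> y ny; rewrite ?v2 ?a2 //= ?v1 ?a1.
by exists s3 => //; apply: EWhileT E2 E3.
Qed.

End Semantics.

(* Variable 2 holds the constant 1; [t] holds the number of iterations left. *)
Definition CFor i t N c :=
  CSeq (CConst i 0) (CSeq (CSub t N i) (CWhile t
    (CSeq c (CSeq (CAdd i i 2) (CSub t N i))))).

(** The three ticks are the assignments to [i] and [t] and the loop test that follows them. *)
Definition for_next i t N k s :=
  HSt (setf (setf (var s) i k) t (N - k)) (arr s) (clk s).+3.

Section ForRule.
Variables (L B : nat) (inp : nat -> nat).

Lemma wp_for (Inv : nat -> hst -> Prop) T i t N n c (Q : hst -> Prop) s :
  uniq [:: i; t; N; 2] -> ~~ has (mem (vars_of c)) [:: i; t; N; 2] ->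
  var s 2 = 1 -> var s N = n -> n < B ->
  Inv 0 (for_next i t n 0 s) ->
  (forall k s', k <= n -> Inv k s' -> clk s' <= T) ->
  (forall k s', k < n -> frame (CFor i t N c) s s' -> var s' i = k ->
     Inv k s' ->
     wp L B inp c (fun s'' => Inv k.+1 (for_next i t n k.+1 s'')) s') ->
  (forall s', frame (CFor i t N c) s s' -> var s' i = n -> Inv n s' -> Q s') ->
  wp L B inp (CFor i t N c) Q s.
Proof.
rewrite /= !inE !negb_or => /andP[/and3P[it iN i2] /andP[/andP[tN t2]]].
rewrite andbT => N2 /and5P[ci ct cN c2 _] one sN nB I0 IT Ib Ie.
apply: vc_wp => /=; split; first by lia.
(* [Inv] speaks of the state after the loop test, hence the [tick]. *)
pose J s' := [/\ var s' 2 = 1, var s' N = n, var s' i <= n,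
  var s' t = n - var s' i & Inv (var s' i) (tick s')].
have nit : (N == i) = false by rewrite eq_sym; apply: negPf.
have nNt : (N == t) = false by rewrite eq_sym; apply: negPf.
have n2i : (2 == i) = false by rewrite eq_sym; apply: negPf.
have n2t : (2 == t) = false by rewrite eq_sym; apply: negPf.
have n2N : (2 == N) = false by rewrite eq_sym; apply: negPf.
have nti : (t == i) = false by rewrite eq_sym; apply: negPf.
have fr s' : frame (CSeq c (CSeq (CAdd i i 2) (CSub t N i)))
    (assign (assign s i 0) t (n - 0)) s' -> frame (CFor i t N c) s s'.
  case=> v a; split=> [x|j] /= nx; last by rewrite a //= cats0.
  rewrite v //=; last by move: nx; rewrite !inE !mem_cat !inE; do !case: eqP.
  by move: nx; rewrite !inE !setfE => /norP[/negPf-> /norP[/negPf-> _]].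
rewrite !setfE eqxx nit sN.
apply: (@wp_while _ _ _ J T).
- by split; rewrite /= ?setfE ?eqxx ?n2i ?n2t ?nit ?nNt ?(negPf it) //; lia.
- by move=> s' [_ _ le_n _ /(IT _ _ le_n)] /=; lia.
- move=> s' /fr F [s1 sN' le_in st I1] pos.
  have lt: var s' i < n by lia.
  apply: vc_wp; rewrite /=; apply: wp_vc.
  apply: wp_conseq (Ib _ (tick s') lt _ erefl I1) _; first by case: F.
  move=> s2 [v a] /= I2.
  have e1: var s2 2 = 1 by rewrite v.
  have eN: var s2 N = n by rewrite v.
  have ei: var s2 i = var s' i by rewrite v.
  rewrite ei e1 addn1; split; first by lia.
  rewrite /J /= !setfE !eqxx n2i n2t nit nNt (negPf it) eN.
  split=> //.
- move=> s' /fr [v a] [s1 sN' le_in st I1] z.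
  have e : var s' i = n by lia.
  by apply: Ie => //; rewrite -e.
Qed.

End ForRule.

(** The RAM has no multiplication, so [(j + 2) * L] is built by adding [L] repeatedly; as [j < 16],
    this is a constant number of instructions. *)
Definition addr j y := IAdd 0 y.+2 1 :: nseq j.+1 (IAdd 0 0 1).

(* Register 0 is scratch, register 1 holds L, and variable x lives in register
   x + 2; array j occupies the L cells from address (j + 2) * L on. *)
Fixpoint compile (p : nat) (c : cmd) : seq instr :=
  match c with
  | CSkip => [::]
  | CConst x k => [:: IConst x.+2 k]
  | CAdd x y z => [:: IAdd x.+2 y.+2 z.+2]
  | CSub x y z => [:: ISub x.+2 y.+2 z.+2]
  | CInp x y => [:: ILoad x.+2 y.+2]
  | CGet x j y => rcons (addr j y) (ILoad x.+2 0)
  | CPut j y x => rcons (addr j y) (IStore 0 x.+2)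
  | CSeq c d => let pc := compile p c in pc ++ compile (p + size pc) d
  | CIf x c d =>
      let pd := compile p.+1 d in
      let p1 := (p.+1 + size pd).+1 in
      let pc := compile p1 c in
      IJumpPos x.+2 p1 :: pd ++ IJumpPos 1 (p1 + size pc) :: pc
  | CWhile x c =>
      let pc := compile p.+2 c in
      [:: IJumpPos x.+2 p.+2, IJumpPos 1 (p.+2 + size pc).+1
        & rcons pc (IJumpPos 1 p)]
  end.

(** * Simulation of commands by compiled code *)

Section Simulation.
Variables (L w : nat) (inp : nat -> nat).
Hypotheses (L_gt0 : 0 < L) (L_le : 20 * L <= 2 ^ w).

(** Register 0 is left free as scratch. All arrays lie from address [2 * L] on, so stores never
    touch the input cells. *)
Definition represents (t : state) (s : hst) :=
  [/\ forall x, reg t x.+2 = var s x, reg t 1 = L,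
      forall j i, j < 16 -> i < L -> Defs.mem t ((j + 2) * L + i) = arr s j i &
      forall a, a < L.*2 -> Defs.mem t a = inp a].

Definition code (P : seq instr) p q :=
  forall i, i < size q -> nth IHalt P (p + i) = nth IHalt q i.

Lemma code_cat P p q1 q2 :
  code P p (q1 ++ q2) -> code P p q1 /\ code P (p + size q1) q2.
Proof.
move=> C; split=> i lt_i.
  by rewrite C ?nth_cat ?lt_i // size_cat ltn_addr.
rewrite -addnA C ?size_cat ?ltn_add2l // nth_cat ltnNge leq_addr /=.
by rewrite addKn.
Qed.

Lemma code_cons P p i q : code P p (i :: q) -> nth IHalt P p = i /\ code P p.+1 q.
Proof. by rewrite -cat1s => /code_cat[/(_ 0 isT)]; rewrite addn0 addn1. Qed.

Lemma steps_adds P k q p t s :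
  code P p (nseq k (IAdd 0 0 1) ++ q) -> pc t = p -> represents t s ->
  reg t 0 + k * L < 2 ^ w ->
  exists t', [/\ iter k (step w P) t = t', represents t' s,
                 reg t' 0 = reg t 0 + k * L & pc t' = p + k].
Proof.
elim: k p t => [|k IHk] p t /=.
  by move=> _ pct rep _; exists t; rewrite !addn0.
case/code_cons=> fp C pct rep lt; have [H1 H2 H3 H4] := rep.
case: t pct {rep} H1 H2 H3 H4 lt => pt R M /= pct H1 H2 H3 H4 lt.
pose t1 := State p.+1 (upd R 0 (R 0 + L)) M.
have e1 : step w P (State pt R M) = t1.
  by rewrite /step /fetch /= pct fp H2 modn_small //; nia.
have [||| t' [<- rep' e0 ep]] := IHk p.+1 t1 C.
- by [].
- by split.
- by rewrite /= /upd /=; nia.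
exists (iter k (step w P) t1); split=> //; first by rewrite -iterS iterSr e1.
- by rewrite e0 /= /upd /=; nia.
- by rewrite ep; lia.
Qed.

Lemma steps_addr P j y q p t s :
  code P p (addr j y ++ q) -> pc t = p -> represents t s ->
  j < 16 -> var s y < L ->
  exists t', [/\ iter j.+2 (step w P) t = t', represents t' s,
                 reg t' 0 = (j + 2) * L + var s y & pc t' = p + j.+2].
Proof.
rewrite cat_cons => /code_cons[fp C] pct [H1 H2 H3 H4] lt_j lt_y.
case: t pct H1 H2 H3 H4 => pt R M /= pct H1 H2 H3 H4.
pose t1 := State p.+1 (upd R 0 (var s y + L)) M.
have e1 : step w P (State pt R M) = t1.
  by rewrite /step /fetch /= pct fp H1 H2 modn_small //; nia.
have [||| t' [<- rep' e0 ep]] := steps_adds (t := t1) (s := s) C.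
- by [].
- by split.
- by rewrite /= /upd /=; nia.
exists (iter j.+1 (step w P) t1); split=> //.
- by rewrite -e1 -iterSr.
- by rewrite e0 /= /upd /=; nia.
- by rewrite ep; lia.
Qed.

Lemma represents_assign t s x v pt R M :
  represents t s -> reg t = R -> Defs.mem t = M ->
  represents (State pt (upd R x.+2 v) M) (assign s x v).
Proof.
move=> [H1 H2 H3 H4] <- <-; split=> //= y.
by rewrite /upd setfE !eqSS; case: eqP.
Qed.

Lemma represents_tick t s pt R M :
  represents t s -> reg t = R -> Defs.mem t = M ->
  represents (State pt R M) (tick s).
Proof. by move=> [H1 H2 H3 H4] <- <-. Qed.

(** Induction on the execution. The factor 20 covers the dearest command, an array access, which
    takes [j + 3 <= 18] instructions for one tick of the clock. *)
Lemma compile_correct c s s' P t :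
  exec L (2 ^ w) inp c s s' -> code P (pc t) (compile (pc t) c) ->
  represents t s ->
  exists k, let t' := iter k (step w P) t in
    [/\ k + 20 * clk s <= 20 * clk s', represents t' s' &
        pc t' = pc t + size (compile (pc t) c)].
Proof.
move=> E; elim: E t => {c s s'}.
- by move=> s t _ rep; exists 0; rewrite addn0.
- move=> s x c lt [p R M] /= /code_cons[fp _] rep; exists 1.
  rewrite /= /fetch /= fp modn_small // addn1; split=> //; first by lia.
  exact: represents_assign rep _ _.
- move=> s x y z lt [p R M] /= /code_cons[fp _] rep; exists 1.
  have [H1 _ _ _] := rep; rewrite /= in H1.
  rewrite /= /fetch /= fp !H1 modn_small // addn1; split=> //; first by lia.
  exact: represents_assign rep _ _.
- move=> s x y z [p R M] /= /code_cons[fp _] rep; exists 1.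
  have [H1 _ _ _] := rep; rewrite /= in H1.
  rewrite /= /fetch /= fp !H1 addn1; split=> //; first by lia.
  exact: represents_assign rep _ _.
- move=> s x y lt [p R M] /= /code_cons[fp _] rep; exists 1.
  have [H1 _ _ H4] := rep; rewrite /= in H1 H4.
  rewrite /= /fetch /= fp !H1 H4 // addn1; split=> //; first by lia.
  exact: represents_assign rep _ _.
- move=> s x j y lt_j lt_y t; 
  rewrite (_ : compile _ _ = addr j y ++ [:: ILoad x.+2 0]); last exact/esym/cats1.
  move=> C rep.
  have [t' [e rep' e0 ep]] := steps_addr C erefl rep lt_j lt_y.
  have [_ /code_cons[fp _]] := code_cat C.
  have sz : size (addr j y) = j.+2 by rewrite /= size_nseq.
  exists j.+3; rewrite iterS e size_cat sz addn1.
  case: t' {e} rep' e0 ep => p R M rep' /= e0 ep.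
  have [H1 _ H3 _] := rep'; rewrite /= in H1 H3.
  rewrite /fetch /= ep -sz fp e0 H3 // addnS; split=> //; first by lia.
  exact: represents_assign rep' _ _.
- move=> s j y x lt_j lt_y t; 
  rewrite (_ : compile _ _ = addr j y ++ [:: IStore 0 x.+2]); last exact/esym/cats1.
  move=> C rep.
  have [t' [e rep' e0 ep]] := steps_addr C erefl rep lt_j lt_y.
  have [_ /code_cons[fp _]] := code_cat C.
  have sz : size (addr j y) = j.+2 by rewrite /= size_nseq.
  exists j.+3; rewrite iterS e size_cat sz addn1.
  case: t' {e} rep' e0 ep => p R M rep' /= e0 ep.
  have [H1 H2 H3 H4] := rep'; rewrite /= in H1 H2 H3 H4.
  rewrite /fetch /= ep -sz fp e0 H1; split; [by rewrite sz /=; lia | | by rewrite /= size_nseq; lia].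
  split=> //= [j' i lt_j' lt_i|a lt_a]; rewrite /upd.
    case: eqP => [e|ne].
      have ej : j' = j by nia.
      by rewrite ej in e *; rewrite setfE eqxx /upd ifT //; apply/eqP; lia.
    rewrite H3 // setfE; case: eqP => [ej|//]; rewrite ej in ne *.
    by rewrite /upd; case: eqP => // ei; case: ne; rewrite ei.
  by rewrite ifF ?H4 //; apply/eqP; nia.
- move=> s1 s2 s3 c d _ IH1 _ IH2 t /= /code_cat[C1 C2] rep.
  have [k1 /= [le1 rep1 p1]] := IH1 t C1 rep.
  have [|k2 /= [le2 rep2 p2]] := IH2 _ _ rep1; first by rewrite p1.
  exists (k2 + k1); rewrite iterD; split=> //; first by lia.
  by rewrite p2 p1 size_cat addnA.
- move=> s s' x c d pos _ IH [p R M] /= /code_cons[fp] /code_cat[_].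
  case/code_cons=> _ C rep.
  have [H1 _ _ _] := rep; rewrite /= in H1.
  have [] := IH (State (p.+1 + size (compile p.+1 d)).+1 R M).
  - by move: C; rewrite addSn.
  - exact: represents_tick rep _ _.
  move=> k /= [le rep' ep]; exists k.+1.
  rewrite iterSr /= /fetch /= fp H1 pos; split=> //; first by lia.
  by rewrite ep size_cat /=; lia.
- move=> s s' x c d z _ IH [p R M] /= /code_cons[fp] /code_cat[C].
  case/code_cons=> fq _ rep.
  have [H1 _ _ _] := rep; rewrite /= in H1.
  have [] := IH (State p.+1 R M) C; first exact: represents_tick rep _ _.
  move=> k /= [le rep' ep]; exists k.+2.
  have e1 : step w P (State p R M) = State p.+1 R M.
    by rewrite /= /fetch /= fp H1 z.
  rewrite iterS iterSr e1.
  case: (iter k _ _) rep' ep => p' R' M' rep' /= ep.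
  have [H1' H2' _ _] := rep'; rewrite /= in H2'.
  (* A jump on register 1 is unconditional, because that register holds [L > 0]. *)
  rewrite /fetch /= ep fq H2' L_gt0; split=> //; first by lia.
  by rewrite size_cat /=; lia.
- move=> s1 s2 s3 x c pos _ IH1 _ IH2 [p R M] C rep.
  have := C; rewrite /= => /code_cons[fp] /code_cons[_].
  rewrite -cats1 => /code_cat[C1] /code_cons[fe _].
  have [H1 _ _ _] := rep; rewrite /= in H1.
  have [] := IH1 (State p.+2 R M) C1; first exact: represents_tick rep _ _.
  move=> k1 /= [le1 rep1 p1].
  have [] := IH2 (State p (reg (iter k1 (step w P) (State p.+2 R M)))
    (Defs.mem (iter k1 (step w P) (State p.+2 R M)))) C.
    by case: rep1.
  move=> k2 [le2 rep2 p2]; exists (k2 + (1 + k1 + 1)).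
  have e1 : step w P (State p R M) = State p.+2 R M.
    by rewrite /= /fetch /= fp H1 pos.
  rewrite iterD (iterD _ _ (step w P) (State p R M)) [iter 1 _ (State _ _ _)]e1 add1n iterS.
  case: (iter k1 _ _) rep1 p1 rep2 p2 => p' R' M' rep1 /= p1 rep2 p2.
  have [_ H2' _ _] := rep1; rewrite /= in H2'.
  rewrite /fetch /= p1 fe H2' L_gt0; split=> //; first by lia.
  by rewrite cats1.
- move=> s x c z [p R M] /= /code_cons[fp] /code_cons[fq _] rep.
  exists 2; have [H1 H2 _ _] := rep; rewrite /= in H1 H2.
  have e1 : step w P (State p R M) = State p.+1 R M.
    by rewrite /= /fetch /= fp H1 z.
  rewrite 2!iterS [iter 0 _ _]/= e1 /= /fetch /= fq H2 L_gt0; split.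
  - by lia.
  - exact: represents_tick rep _ _.
  - by rewrite /= size_rcons; lia.
Qed.

End Simulation.

(** The prologue reads the first two input cells and puts their sum plus 2, which is [L], into
    register 1; the epilogue copies variable [r] to the output register. The body starts at position
    6. *)
Definition program c r :=
  [:: ILoad 2 0; IConst 0 1; ILoad 3 0; IAdd 1 2 3; IConst 0 2; IAdd 1 1 0] ++
  compile 6 c ++ [:: IConst 0 0; IAdd 0 0 r.+2].

(** The prologue leaves data in the registers of variables 0 and 1, so [c] is required to work from
    any variables [R0]. The arrays start at zero because they lie beyond the input. The 8 extra
    steps are the prologue and the epilogue. *)
Lemma program_correct w n m input c r T x :
  let L := n + m + 2 in
  nth 0 input 0 = n -> nth 0 input 1 = m -> size input <= L.*2 ->
  20 * L <= 2 ^ w ->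
  (forall R0, wp L (2 ^ w) (nth 0 input) c
     (fun s => [/\ var s r = x, x < 2 ^ w & clk s <= T])
     (HSt R0 (fun _ _ => 0) 0)) ->
  outputs_within w (program c r) input (20 * T + 8) x.
Proof.
move=> L en em sz Lw /(_ (fun y => nth 0 [:: n; m] y)) [s' E [ex xw cT]].
set P := program c r.
pose R1 := upd (upd (upd (upd (upd (upd (fun=> 0) 2 n) 0 1) 3 m) 1 (n + m)) 0 2) 1 L.
pose t1 := State 6 R1 (nth 0 input).
have e1 : iter 6 (step w P) (init input) = t1.
  rewrite /init /= /fetch /= en /upd /= !modn_small; try lia.
  by rewrite em.
have C : code P 6 (compile 6 c ++ [:: IConst 0 0; IAdd 0 0 r.+2]).
  by move=> i lt_i; rewrite /P /program nth_cat ltnNge leq_addr /= addKn.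
have [C1 /code_cons[f1 /code_cons[f2 _]]] := code_cat C.
have rep : represents L (nth 0 input) t1 (HSt (nth 0 [:: n; m]) (fun _ _ => 0) 0).
  split=> //= [[|[|y]] //|j i _ lt_i].
    by rewrite /R1 /upd /= nth_nil.
  by rewrite nth_default //; nia.
have szP : size P = 6 + size (compile 6 c) + 2.
  by rewrite /P /program !size_cat /=; lia.
clearbody P.
have L0 : 0 < L by rewrite /L; lia.
have [k [le_k rk pk]] := compile_correct (t := t1) L0 Lw E C1 rep.
rewrite /= in le_k.
exists (1 + 1 + k + 6); rewrite !iterD e1; case: (iter k _ _) rk pk => p R M.
move=> [H1 _ _ _] pk; rewrite /= in H1 pk.
have it1 t : iter 1 (step w P) t = step w P t by [].
have e2 : step w P (State p R M) = State p.+1 (upd R 0 0) M.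
  by rewrite /= /fetch /= pk f1 mod0n.
have e3 : step w P (State p.+1 (upd R 0 0) M) = State p.+2 (upd (upd R 0 0) 0 x) M.
  by rewrite /= /fetch /= pk f2 /upd /= H1 ex modn_small.
rewrite !it1 e2 e3; split; first by lia.
  by rewrite /halted /fetch nth_default // szP /= pk; lia.
by rewrite /upd.
Qed.

(** * Contractions and single connectedness *)

Section Contraction.
Variables V E : finType.
Implicit Types (G H : digraph V E) (u v w : V) (e f : E) (p q : seq E).

Definition rev_graph G := Digraph (verts G) (edges G) (tgt G) (src G).

Lemma contract_all_out_rev G o :
  contract_all_out G o = rev_graph (contract_all_in (rev_graph G) o).
Proof.
have step H v : contract_out (rev_graph H) v = rev_graph (contract_in H v).
  by rewrite /contract_out /contract_in -[out_edges _ v]/(in_edges H v);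
     case: unset1.
have revK H : rev_graph (rev_graph H) = H by case: H.
rewrite -{1}[G]revK; elim: o (rev_graph G) => //= v o IHo H.
by rewrite step IHo.
Qed.

Definition closed_graph G :=
  forall e, e \in edges G -> (src G e \in verts G) && (tgt G e \in verts G).

(** A certificate of acyclicity that survives contraction. The processing orders supply the rank, as
    the index of a vertex in the list. *)
Definition ranked (rk : V -> nat) G :=
  forall e, e \in edges G -> rk (tgt G e) < rk (src G e).

(** [lab v] is the first vertex of indegree other than 1 met when climbing unique incoming edges
    from [v]; the clauses are the base case and the recursion of that climb. *)
Definition is_root_map G (lab : V -> V) :=
  (forall v, #|in_edges G v| != 1 -> lab v = v) /\
  (forall e, e \in edges G -> #|in_edges G (tgt G e)| = 1 ->
     lab (tgt G e) = lab (src G e)).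

Lemma in_edges1 G e : e \in edges G -> #|in_edges G (tgt G e)| = 1 ->
  in_edges G (tgt G e) = [set e].
Proof.
move=> Ee /eqP/cards1P[f Df].
have: e \in in_edges G (tgt G e) by rewrite inE Ee eqxx.
by rewrite Df inE => /eqP->.
Qed.

Lemma in_edges_unset1 G v e :
  unset1 (in_edges G v) = Some e -> in_edges G v = [set e].
Proof. by have := unset1K (in_edges G v) => + Du; rewrite Du. Qed.

(** Each proper step of [up] raises the rank, so iterating it as often as the maximal rank [M]
    reaches a fixed point. *)
Lemma root_map_exists G rk : ranked rk G -> exists lab, is_root_map G lab.
Proof.
move=> rkG; pose up v := if unset1 (in_edges G v) is Some e then src G e else v.
pose M := \max_v rk v.
have le_M v : rk v <= M by apply: leq_bigmax.
have upP v : up v = v \/ rk v < rk (up v).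
  rewrite /up; case Du: (unset1 _) => [e|]; [right | by left].
  have: e \in in_edges G v by rewrite (in_edges_unset1 Du) set11.
  by rewrite inE => /andP[Ee /eqP <-]; apply: rkG.
have fix_up k v : up v = v -> iter k up v = v by move=> e; elim: k => //= k ->.
have stab k v : M - rk v <= k -> up (iter k up v) = iter k up v.
  elim: k v => [|k IHk] v le_k.
    by have := le_M (up v); case: (upP v) => //= lt; lia.
  have := le_M (up v); case: (upP v) => [e|lt le]; first by rewrite !fix_up.
  by rewrite iterSr; apply: IHk; lia.
exists (iter M up); split=> [v n1|e Ee d1].
  apply: fix_up; rewrite /up; case Du: (unset1 _) => [e|//].
  by rewrite (in_edges_unset1 Du) cards1 in n1.
have -> : src G e = up (tgt G e).
  by rewrite /up (in_edges1 Ee d1) set1K.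
by rewrite -iterSr iterS stab // leq_subr.
Qed.

(** This closed form is what the program computes: which vertices and edges survive is read off the
    indegrees in [G], and new sources are given by the root map. That a new source is the source of
    some edge of [G] later keeps isolated vertices isolated. *)
Lemma contract_all_inP G o rk lab :
    closed_graph G -> ranked rk G -> is_root_map G lab ->
    uniq o -> {subset verts G <= o} ->
  let H := contract_all_in G o in
  [/\ verts H = [set v in verts G | #|in_edges G v| != 1],
      edges H = [set e in edges G | #|in_edges G (tgt G e)| != 1],
      tgt H = tgt G,
      forall e, e \in edges H -> src H e = lab (src G e) &
      forall e, e \in edges H -> [/\ src H e \in verts H,
        rk (tgt H e) < rk (src H e) &
        exists2 f, f \in edges G & src H e = src G f]].
Proof.
move=> wfG rkG [lab0 lab1] uo so /=.
pose D (s : seq V) v := (v \in s) && (#|in_edges G v| == 1).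
(* Invariant after a prefix of [o], with [D] marking the vertices merged so far: sources may move,
   but their label does not. At the end every source is a kept vertex, hence equal to its own
   label. *)
suff [vH eH tH labH srcH]: let H := contract_all_in G o in
  [/\ verts H = [set v in verts G | ~~ D o v],
      edges H = [set e in edges G | ~~ D o (tgt G e)],
      tgt H = tgt G,
      forall e, e \in edges H -> lab (src H e) = lab (src G e) &
      forall e, e \in edges H -> [/\ src H e \in verts H,
        rk (tgt H e) < rk (src H e) &
        exists2 f, f \in edges G & src H e = src G f]].
  have vH' : verts (contract_all_in G o) = [set v in verts G | #|in_edges G v| != 1].
    by rewrite vH; apply/setP=> v; rewrite !inE; case: (boolP (v \in _)) => // /so vo;
       rewrite /D vo.
  split=> // [|e He].
    rewrite eH; apply/setP=> e; rewrite !inE; case: (boolP (e \in _)) => // /wfG/andP[_ /so to].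
    by rewrite /D to.
  have [+ _ _] := srcH e He; rewrite vH' inE => /andP[_ /lab0 <-].
  exact: labH.
elim/last_ind: o uo {so} => [|o v IHo] /=.
  move=> _; split=> //; try by apply/setP=> x; rewrite !inE andbT.
  by move=> e Ee; split; [case/andP: (wfG e Ee) | apply: rkG | exists e].
rewrite rcons_uniq /contract_all_in -cats1 foldl_cat /= => /andP[nv /IHo].
rewrite -/(contract_all_in G o); set H := contract_all_in G o.
move=> [vH eH tH labH srcH].
have Dv : D o v = false by rewrite /D (negPf nv).
(* [v] is not yet processed, so no edge entering it has been deleted and the test in [contract_in]
   sees the indegree from [G]. *)
have inv : in_edges H v = in_edges G v.
  apply/setP=> e; rewrite !inE eH tH inE; case: eqP => [->|]; last by rewrite !andbF.
  by rewrite Dv !andbT.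
have Dcat x : D (o ++ [:: v]) x = D o x || (x == v) && (#|in_edges G v| == 1).
  by rewrite /D mem_cat inE andb_orl; case: (x =P v) => [->|_].
rewrite /contract_in inv; case Du: (unset1 _) => [e|].
  have De := in_edges_unset1 Du.
  have c1 : #|in_edges G v| == 1 by rewrite De cards1.
  have /andP[Ee /eqP te] : (e \in edges G) && (tgt G e == v).
    by have := set11 e; rewrite -De inE.
  have EHe : e \in edges H by rewrite eH inE Ee te Dv.
  have [sHe rHe oHe] := srcH e EHe.
  have nsv : src H e != v by apply: contraTneq rHe => ->; rewrite tH te ltnn.
  split=> //=.
  - apply/setP=> x; rewrite !inE vH !inE Dcat c1 andbT negb_or.
    by rewrite andbC -andbA.
  - apply/setP=> f; rewrite !inE eH !inE Dcat c1 andbT negb_or.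
    case: (boolP (f \in edges G)) => [Ef|]; last by rewrite !andbF.
    have -> : (tgt G f == v) = (f == e).
      by have := in_set1 f e; rewrite -De inE Ef.
    by rewrite andbC.
  - move=> f; rewrite inE => /andP[nfe Hf]; rewrite -(labH f Hf).
    case: (src H f =P v) => // ->; rewrite (labH e EHe) -te lab1 //.
    by rewrite te; apply/eqP.
  - move=> f; rewrite !inE => /andP[nfe Hf].
    have [sf rf of_] := srcH f Hf.
    case: (src H f =P v) => [sv|/eqP nsf]; last by rewrite nsf.
    split=> //; first by rewrite nsv.
    by apply: ltn_trans rHe; rewrite tH te -sv -tH.
have c1 : (#|in_edges G v| == 1) = false.
  by apply/negbTE/negP=> /cards1P[e De]; rewrite De set1K in Du.
have Dcat' x : D (o ++ [:: v]) x = D o x by rewrite Dcat c1 andbF orbF.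
split=> //.
  by rewrite vH; apply/setP=> x; rewrite !inE Dcat'.
by rewrite eH; apply/setP=> x; rewrite !inE Dcat'.
Qed.

(** Collects what the second pass and the search require of one pass. The last clause serves to
    count the isolated vertices of the input among both the sources and the sinks of the result. *)
Lemma contract_all_in_props G o rk :
    closed_graph G -> ranked rk G -> uniq o -> {subset verts G <= o} ->
  let H := contract_all_in G o in
  [/\ closed_graph H, ranked rk H, {in verts H, forall v, #|in_edges H v| != 1} &
      forall v, v \in verts G -> in_edges G v = set0 -> out_edges G v = set0 ->
        [/\ v \in verts H, in_edges H v = set0 & out_edges H v = set0]].
Proof.
move=> clG rkG uo so; have [lab labP] := root_map_exists rkG.
have /= := contract_all_inP clG rkG labP uo so.
set H := contract_all_in G o => -[vH eH tH sH rH].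
have inH v : #|in_edges G v| != 1 -> in_edges H v = in_edges G v.
  move=> d1; apply/setP=> e; rewrite !inE eH tH inE.
  by case: (tgt G e =P v) => [->|]; rewrite ?d1 ?andbT ?andbF.
split.
- move=> e He; have [-> _ _] := rH e He; rewrite vH tH inE.
  by move: He; rewrite eH inE => /andP[/clG/andP[_ ->]].
- by move=> e /rH[].
- by move=> v; rewrite vH inE => /andP[_ d1]; rewrite inH.
move=> v Gv in0 out0; have d1 : #|in_edges G v| != 1 by rewrite in0 cards0.
rewrite vH inE Gv d1 inH //; split=> //; apply/setP=> e; rewrite !inE.
apply/negP=> /andP[/rH[_ _ [f Gf ->]] sf].
by have := in_set0 f; rewrite -out0 inE Gf sf.
Qed.

End Contraction.

(** * Single connectedness tested from the sources *)

Section Connectivity.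
Variables V E : finType.
Variables (G : digraph V E) (rk : V -> nat).
Hypotheses (closedG : closed_graph G) (rkG : ranked rk (rev_graph G)).

Definition reach r x := exists p, is_walk G r p x.

Lemma walk_cat u p v q w :
  is_walk G u p v -> is_walk G v q w -> is_walk G u (p ++ q) w.
Proof.
elim: p u => [|e p IHp] u /= => [/eqP->//|/and3P[-> -> /IHp Wp] Wq].
exact: Wp.
Qed.

Lemma walk_rcons u p e w : is_walk G u (rcons p e) w =
  [&& is_walk G u p (src G e), e \in edges G & tgt G e == w].
Proof.
elim: p u => [|f p IHp] u /=; last by rewrite IHp -!andbA.
by rewrite [u == _]eq_sym andbCA.
Qed.

Lemma reach_refl r : reach r r. Proof. by exists [::] => /=. Qed.

Lemma reach_step r e : e \in edges G -> reach r (src G e) -> reach r (tgt G e).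
Proof.
by move=> Ee [p Wp]; exists (rcons p e); rewrite walk_rcons Wp Ee /=.
Qed.

(** The rank strictly increases along a walk, so no vertex repeats. *)
Lemma walk_simple u p w : is_walk G u p w -> simple_path G u p w.
Proof.
move=> Wp; rewrite /simple_path Wp.
apply: (@sorted_uniq _ (relpre rk ltn)).
- by move=> x y z; apply: ltn_trans.
- by move=> x /=; rewrite ltnn.
elim: p u Wp => //= e p IHp u /and3P[Ee /eqP <- /IHp] /=.
by have := rkG Ee; rewrite /= => -> ->.
Qed.

(** Going back along incoming edges lowers the rank and must end at a source. *)
Lemma source_above v :
  v \in verts G -> exists2 r, r \in sources G & reach r v.
Proof.
have [k] := ubnP (rk v); elim: k v => // k IHk v lt_k Gv.
case: (set_0Vmem (in_edges G v)) => [v0|[e]].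
  by exists v; [rewrite inE Gv v0 eqxx | apply: reach_refl].
rewrite inE => /andP[Ee /eqP te].
have /andP[Gs _] := closedG Ee.
have := rkG Ee; rewrite /= te => lt.
have [|r Sr rs] := IHk (src G e) _ Gs; first by lia.
by exists r => //; rewrite -te; apply: reach_step.
Qed.

(** For a source [r] of an acyclic graph this says that the part reachable from [r] is an
    out-tree. *)
Definition in_tree r := forall e f, e \in edges G -> f \in edges G ->
  reach r (src G e) -> reach r (src G f) -> tgt G e = tgt G f -> e = f.

Lemma source_no_edge r e : r \in sources G -> e \in edges G -> tgt G e != r.
Proof.
rewrite inE => /andP[_ /eqP r0] Ee; apply/negP=> te.
by have := in_set0 e; rewrite -r0 inE Ee te.
Qed.

(** Two edges with a common target, both reachable from [r], extend to two walks from [r], which are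
    simple by acyclicity. Conversely, two paths from [v] are prolonged backwards to a source above
    [v]; there, comparing last edges shows that the walks agree edge by edge, and the common prefix
    cancels. *)
Lemma singly_connectedP :
  singly_connected G <-> forall r, r \in sources G -> in_tree r.
Proof.
split=> [sc r Sr e f Ee Ef [p Wp] [q Wq] tef|tree v w Gv _ p q].
  have Gr : r \in verts G by move: Sr; rewrite inE => /andP[].
  have /andP[_ Gt] := closedG Ee.
  have /rcons_inj[_ //]: rcons p e = rcons q f.
  apply: (sc _ _ Gr Gt); apply: walk_simple; rewrite walk_rcons.
    by rewrite Wp Ee eqxx.
  by rewrite Wq Ef tef eqxx.
move=> /andP[Wp _] /andP[Wq _].
have [r Sr [x Wx]] := source_above Gv.
have: x ++ p = x ++ q.
  move: (walk_cat Wx Wp) (walk_cat Wx Wq); move: (x ++ p) (x ++ q) => p' q'.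
  elim/last_ind: p' q' w {p q Wp Wq} => [|p e IHp] q w.
    move=> /= /eqP <-; case/lastP: q => // q f; rewrite walk_rcons.
    by case/and3P=> _ /(source_no_edge Sr) /negPf->.
  rewrite walk_rcons => /and3P[Wp Ee /eqP <-].
  case/lastP: q => [/= /eqP er|q f].
    by have := source_no_edge Sr Ee; rewrite er eqxx.
  rewrite walk_rcons => /and3P[Wq Ef /eqP tef].
  have ef : e = f by apply: (tree r) => //; [exists p | exists q].
  by rewrite ef; congr rcons; apply: IHp Wq; rewrite -ef.
by move/eqP; rewrite eqseq_cat // eqxx => /eqP.
Qed.

End Connectivity.

(** * Size of an out-tree without unary vertices *)

Section TreeSize.
Variables (V E : finType) (G : digraph V E).

Lemma card_edges_from (Q : {set V}) :
  #|[set e in edges G | src G e \in Q]| = \sum_(x in Q) #|out_edges G x|.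
Proof.
rewrite -sum1_card (partition_big (src G) (mem Q)) /=; last first.
  by move=> e; rewrite inE => /andP[].
apply: eq_bigr => x Qx; rewrite -sum1_card; apply: eq_bigl => e.
by rewrite !inE; case: eqP => [->|]; rewrite ?Qx ?andbT ?andbF.
Qed.

(** A vertex of [Q] that is not a sink has outdegree at least 2, so with [t] sinks the [|Q| - 1]
    edges leaving [Q] number at least [2 * (|Q| - t)]. *)
Lemma tree_size (Q : {set V}) :
    Q \subset verts G -> {in verts G, forall v, #|out_edges G v| != 1} ->
    #|[set e in edges G | src G e \in Q]|.+1 = #|Q| ->
  #|Q| <= 2 * #|sinks G|.
Proof.
move=> sQ out1; rewrite card_edges_from => szQ.
have : \sum_(x in Q) 2 * (x \notin sinks G) <= \sum_(x in Q) #|out_edges G x|.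
  apply: leq_sum => x /(subsetP sQ) Gx; rewrite inE Gx /=.
  have := out1 x Gx; rewrite -cards_eq0.
  by case: #|_| => [|[|k]].
have : \sum_(x in Q) 2 * (x \notin sinks G) + 2 * #|sinks G| >= 2 * #|Q|.
  rewrite -big_distrr /= -mulnDr leq_mul2l /=.
  rewrite -sum1_card [X in X <= _](bigID (mem (sinks G))) /= addnC leq_add //.
    by rewrite big_mkcondr; apply: leq_sum => x _ /=; case: (x \in sinks G).
  rewrite sum1_card; apply: subset_leq_card; apply/subsetP=> x.
  by case/andP.
move: (\sum_(x in Q) 2 * _) (\sum_(x in Q) _) #|Q| #|sinks G| szQ.
by move=> *; lia.
Qed.

End TreeSize.

(** * The program and its running time *)

Local Notation vN := 0 (only parsing).
Local Notation vM := 1 (only parsing).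
Local Notation vOne := 2 (only parsing).
Local Notation vI := 3 (only parsing).
Local Notation vT := 4 (only parsing).
Local Notation vA := 5 (only parsing).
Local Notation vB := 6 (only parsing).
Local Notation vC := 7 (only parsing).
Local Notation vD := 8 (only parsing).
Local Notation vU := 9 (only parsing).
Local Notation vSp := 10 (only parsing).
Local Notation vOk := 11 (only parsing).
Local Notation vHd := 12 (only parsing).
Local Notation vTl := 13 (only parsing).
Local Notation vS := 14 (only parsing).
Local Notation vL := 15 (only parsing).
Local Notation vW := 16 (only parsing).
Local Notation vQ := 17 (only parsing).

(* A vertex that is the KEY of exactly one edge is merged into the VAL of that
   edge. FLG and ALV mark the edges and vertices still present. A vertex is
   merged into LAB - 1, with LAB = 0 as long as this is unknown. NSR marks the
   vertices that are not sources; HED and LNK are the adjacency lists. *)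
Local Notation KEY := 0 (only parsing).
Local Notation VAL := 1 (only parsing).
Local Notation FLG := 2 (only parsing).
Local Notation ALV := 3 (only parsing).
Local Notation DEG := 4 (only parsing).
Local Notation PTR := 5 (only parsing).
Local Notation LAB := 6 (only parsing).
Local Notation VIS := 7 (only parsing).
Local Notation STK := 8 (only parsing).
Local Notation NSR := 9 (only parsing).
Local Notation HED := 10 (only parsing).
Local Notation LNK := 11 (only parsing).
Local Notation QUE := 12 (only parsing).
Local Notation MRK := 13 (only parsing).

Arguments setf T f a x b /.

Ltac vcs := repeat first
  [ apply: conj; [by lia|] | apply: And3; [by []|by lia|] ].

Declare Scope cmd_scope.
Local Open Scope cmd_scope.
Local Notation "c ;; d" := (CSeq c d) (at level 90, right associativity) : cmd_scope.
Local Notation "x <-- y" := (CConst x y) (at level 80, y at level 30) : cmd_scope.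
Local Notation "x <-- y [+] z" := (CAdd x y z) (at level 80, y at level 30) : cmd_scope.
Local Notation "x <-- y [-] z" := (CSub x y z) (at level 80, y at level 30) : cmd_scope.
Local Notation "x <-- j @@ y" := (CGet x j y) (at level 80, j at level 30) : cmd_scope.
Local Notation "j @@ y <== x" := (CPut j y x) (at level 80, y at level 30) : cmd_scope.

(** Edge [i] occupies input cells [2 * i + 2] and [2 * i + 3]. The target becomes the [KEY], because
    the first pass merges along unique incoming edges; [swap] turns this round for the second
    pass. *)
Definition load :=
  vA <-- 0;; CInp vN vA;; vOne <-- 1;; CInp vM vOne;;
  CFor vI vT vM (
    vA <-- vI [+] vI;; vB <-- 2;; vA <-- vA [+] vB;; CInp vC vA;;
    VAL @@ vI <== vC;; vA <-- vA [+] vOne;; CInp vC vA;;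
    KEY @@ vI <== vC;; FLG @@ vI <== vOne);;
  CFor vI vT vN (ALV @@ vI <== vOne).

(** [contract] runs twice, and the second run must not see the degrees, labels and visit marks of
    the first. *)
Definition clear :=
  CFor vI vT vN (
    vA <-- 0;; DEG @@ vI <== vA;; LAB @@ vI <== vA;; VIS @@ vI <== vA).

(** [PTR] keeps the other end of the last edge counted, which is the parent to merge into when the
    final degree is 1. *)
Definition count_in :=
  CFor vI vT vM (
    vA <-- FLG @@ vI;;
    CIf vA (
      vB <-- KEY @@ vI;; vC <-- VAL @@ vI;; PTR @@ vB <== vC;;
      vD <-- DEG @@ vB;; vD <-- vD [+] vOne;; DEG @@ vB <== vD) CSkip).

(* The test [vB > 0] says that the degree is not 1. *)
Definition mark_roots :=
  CFor vI vT vN (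
    vA <-- DEG @@ vI;;
    vB <-- vA [-] vOne;; vC <-- vOne [-] vA;; vB <-- vB [+] vC;;
    CIf vB (
      vD <-- vI [+] vOne;; LAB @@ vI <== vD;; VIS @@ vI <== vOne)
      (ALV @@ vI <== vB)).

(** One step of a climb. The path waits on [STK] until a visited vertex is met; [pop_path] then
    gives the label of that vertex to the whole path. *)
Definition push_path :=
  STK @@ vSp <== vU;; vSp <-- vSp [+] vOne;; VIS @@ vU <== vOne;;
  vU <-- PTR @@ vU;; vA <-- VIS @@ vU;; vC <-- vOne [-] vA.

Definition pop_path :=
  vSp <-- vSp [-] vOne;; vB <-- STK @@ vSp;; LAB @@ vB <== vA.

(* Every push marks a fresh vertex, so all climbs together take linear time. *)
Definition label_roots :=
  CFor vI vT vN (
    vSp <-- 0;; vU <-- vI [+] vSp;; vA <-- VIS @@ vU;; vC <-- vOne [-] vA;;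
    CWhile vC push_path;;
    vA <-- LAB @@ vU;;
    CWhile vSp pop_path).

(** A present edge whose key has degree 1 is itself the contracted edge and loses its flag; every
    other present edge has its source moved to the root. *)
Definition relabel :=
  CFor vI vT vM (
    vA <-- FLG @@ vI;;
    CIf vA (
      vB <-- KEY @@ vI;; vC <-- DEG @@ vB;;
      vA <-- vC [-] vOne;; vD <-- vOne [-] vC;; vA <-- vA [+] vD;;
      CIf vA (
        vB <-- VAL @@ vI;; vC <-- LAB @@ vB;; vC <-- vC [-] vOne;;
        VAL @@ vI <== vC)
        (FLG @@ vI <== vA)) CSkip).

Definition contract := clear;; count_in;; mark_roots;; label_roots;; relabel.

Definition swap :=
  CFor vI vT vM (
    vA <-- KEY @@ vI;; vB <-- VAL @@ vI;; KEY @@ vI <== vB;; VAL @@ vI <== vA).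

(* Out-edges are kept in singly linked lists; a link holds the next edge plus
   one, or 0 at the end of the list. *)
Definition build :=
  CFor vI vT vM (
    vA <-- FLG @@ vI;;
    CIf vA (
      vB <-- KEY @@ vI;; vC <-- HED @@ vB;; LNK @@ vI <== vC;;
      vD <-- vI [+] vOne;; HED @@ vB <== vD;;
      vB <-- VAL @@ vI;; NSR @@ vB <== vOne) CSkip).

(** [MRK] holds the stamp, root plus one, of the latest search that reached a vertex, so all
    searches share the array without clearing it. Meeting the current stamp again ends the scan with
    a negative answer. *)
Definition scan_edge :=
  vL <-- vL [-] vOne;; vW <-- VAL @@ vL;; vA <-- MRK @@ vW;;
  vB <-- vA [-] vS;; vC <-- vS [-] vA;; vB <-- vB [+] vC;;
  CIf vB (
    MRK @@ vW <== vS;; QUE @@ vTl <== vW;; vTl <-- vTl [+] vOne;;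
    vL <-- LNK @@ vL)
    (vOk <-- 0;; vL <-- 0).

(** [vQ] is the number of waiting vertices, forced to 0 after a collision so that the search
    stops. *)
Definition scan_vertex :=
  vU <-- QUE @@ vHd;; vHd <-- vHd [+] vOne;; vL <-- HED @@ vU;;
  CWhile vL scan_edge;;
  vQ <-- vTl [-] vHd;;
  CIf vOk CSkip (vQ <-- 0).

Definition bfs :=
  vHd <-- 0;; vTl <-- 1;; vQ <-- 1;; QUE @@ vHd <== vI;;
  vS <-- vI [+] vOne;; MRK @@ vI <== vS;;
  CWhile vQ scan_vertex.

(** The difference of [ALV] and [NSR] is 1 exactly at the sources. After a failure it is overwritten
    by 0, so the remaining iterations take constant time. *)
Definition search :=
  vOk <-- 1;;
  CFor vI vT vN (
    vA <-- ALV @@ vI;; vB <-- NSR @@ vI;; vA <-- vA [-] vB;;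
    CIf vOk CSkip (vA <-- 0);;
    CIf vA bfs CSkip).

Definition test_reduced :=
  load;; contract;; swap;; contract;; build;; search.

Lemma card_lt_step N (A : {set 'I_N}) k (lt_k : k < N) :
  #|[set e in A | e < k.+1]| =
  (Ordinal lt_k \in A) + #|[set e in A | e < k]|.
Proof.
have -> : [set e in A | e < k.+1] =
    (if Ordinal lt_k \in A then [set Ordinal lt_k] else set0)
      :|: [set e in A | e < k].
  apply/setP=> e; rewrite !inE ltnS leq_eqVlt.
  case: (eqVneq e (Ordinal lt_k)) => [->|ne] /=.
    by rewrite eqxx ltnn; case: ifP => h; rewrite !inE ?eqxx ?h.
  rewrite (_ : (e == k :> nat) = false); last first.
    by apply: contraNF ne => /eqP ek; apply/eqP/val_inj.
  by case: ifP; rewrite !inE ?(negPf ne).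
case: ifP => _; last by rewrite set0U.
by rewrite cardsU1 !inE ltnn andbF.
Qed.

Lemma uniq_map_inj (S T : eqType) (f : S -> T) (es : seq S) :
  uniq (map f es) -> {in es &, injective f}.
Proof.
elim: es => //= e es IHes /andP[ne /IHes inj] x y; rewrite !inE.
case/predU1P=> [->|xs] /predU1P[->|ys] // fxy; last exact: inj.
  by rewrite fxy map_f in ne.
by rewrite -fxy map_f in ne.
Qed.

Fixpoint linked m (lnk : nat -> nat) (l : nat) (es : seq 'I_m) : Prop :=
  if es is e :: es' then l = e.+1 /\ linked lnk (lnk e) es' else l = 0.

Lemma linked_upd m lnk (e : 'I_m) x l es :
  e \notin es -> linked lnk l es -> linked (upd lnk e x) l es.
Proof.
elim: es l => //= f es IHes l; rewrite inE => /norP[nef nes] [-> Hl].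
split=> //; rewrite {2}/upd ifF; first exact: IHes.
by apply: contraNF nef => /eqP/val_inj->.
Qed.

(** * Correctness of the linear-time passes *)

Section Verification.
Variables (n m B : nat) (inp : nat -> nat).
Local Notation L := (n + m + 2).
Hypothesis L_le : 20 * L <= B.
Implicit Types (H : digraph 'I_n 'I_m) (s : hst).
Local Notation wp := (wp L B inp).

(** [KEY] and [VAL] are constrained at present edges only, as deleted edges keep stale entries. *)
Definition stores H s :=
  [/\ [/\ var s vN = n, var s vM = m & var s vOne = 1],
      forall v : 'I_n, arr s ALV v = (v \in verts H),
      forall e : 'I_m, arr s FLG e = (e \in edges H) &
      forall e : 'I_m, e \in edges H ->
        arr s KEY e = tgt H e /\ arr s VAL e = src H e].

Lemma load_correct (a b : 'I_m -> 'I_n) R0 A0 :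
  inp 0 = n -> inp 1 = m ->
  (forall e : 'I_m, inp (e + e + 2) = a e) ->
  (forall e : 'I_m, inp (e + e + 2 + 1) = b e) ->
  wp load (fun s => [/\ stores (input_graph a b) s, clk s <= 20 * L &
     forall j, 4 <= j -> arr s j = A0 j]) (HSt R0 A0 0).
Proof.

move=> i0 i1 ia ib; rewrite /load.
do 4!(apply: wp_seq; apply: vc_wp => /=; split; first by lia).
rewrite i0 i1; apply: wp_seq.
(* An iteration costs nine commands and three ticks of loop control; four commands and the entry
   into the loop make up the 7. *)
apply: (wp_for (n := m) (T := 20 * L) (Inv := fun k s =>
  (forall e : 'I_m, e < k -> [/\ arr s VAL e = a e, arr s KEY e = b e & arr s FLG e = 1])
  /\ clk s <= 7 + 12 * k)) => //=; try lia.
- move=> k s' lt_k [fv fa] ik [IH ck]; apply: vc_wp => /=.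
  have e2 : var s' vOne = 1 := fv vOne isT.
  have Ek := ia (Ordinal lt_k); have Fk := ib (Ordinal lt_k); rewrite /= in Ek Fk.
  rewrite ik e2 Ek Fk; vcs.
  split; last by lia.
  move=> e le_e; rewrite /upd; case: eqP => [ek|nk]; last by apply: IH; lia.
  by rewrite (_ : e = Ordinal lt_k) //; apply: val_inj.
move=> s1 [fv fa] im [IH c1].
apply: (wp_for (n := n) (T := 20 * L) (Inv := fun k s =>
  (forall v : 'I_n, v < k -> arr s ALV v = 1) /\ clk s <= 10 + 12 * m + 12 * k)) => //=.
- exact: fv vOne isT.
- exact: fv vN isT.
- by lia.
- by split=> //; lia.
- by move=> k s le_k [_]; lia.
- move=> k s lt_k [fv' fa'] ik [IH' ck]; apply: vc_wp => /=.
  have e2 : var s vOne = 1 by rewrite (fv' vOne isT); exact: fv vOne isT.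
  rewrite ik e2; vcs; split; last by lia.
  move=> e le_e; rewrite /upd; case: eqP => [//|nk]; by apply: IH'; lia.
move=> s [fv' fa'] _ [IH' c']; split; last 1 first.
- move=> j; case: j => [|[|[|[|j]]]] // _; rewrite (fa' j.+4 isT); exact: fa j.+4 isT.
- split; [split| |move=> e|move=> e _].
  + rewrite (fv' vN isT); exact: fv vN isT.
  + rewrite (fv' vM isT); exact: fv vM isT.
  + rewrite (fv' vOne isT); exact: fv vOne isT.
  + by move=> v; rewrite inE IH'.
  + by have [_ _] := IH e (ltn_ord e); rewrite (fa' FLG isT) inE.
  + by have [? ? _] := IH e (ltn_ord e); rewrite (fa' KEY isT) (fa' VAL isT).
by lia.
Qed.

Definition header s := [/\ var s vN = n, var s vM = m & var s vOne = 1].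

Lemma clear_correct s : header s ->
  wp clear (fun s' => (forall v : 'I_n,
      [/\ arr s' DEG v = 0, arr s' LAB v = 0 & arr s' VIS v = 0])
    /\ clk s' <= clk s + 40 * L) s.
Proof.
move=> [eN _ e1].
apply: (wp_for (n := n) (T := clk s + 40 * L) (Inv := fun k s' =>
  (forall v : 'I_n, v < k -> [/\ arr s' DEG v = 0, arr s' LAB v = 0 & arr s' VIS v = 0])
  /\ clk s' <= clk s + 3 + 7 * k)) => //=.
- by lia.
- by split=> //; lia.
- by move=> k s' le_k [_]; lia.
- move=> k s' lt_k _ ik [IH ck]; apply: vc_wp => /=.
  rewrite ik; vcs; split; last by lia.
  by move=> v le_v; rewrite /upd; case: eqP => // nk; apply: IH; lia.
by move=> s' _ _ [IH c']; split; [move=> v; apply: IH | lia].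
Qed.

Lemma count_in_correct H s : stores H s -> (forall v : 'I_n, arr s DEG v = 0) ->
  wp count_in (fun s' => [/\ forall v : 'I_n, arr s' DEG v = #|in_edges H v|,
     forall v : 'I_n, 0 < arr s' DEG v ->
       exists2 e, e \in in_edges H v & arr s' PTR v = src H e
   & clk s' <= clk s + 40 * L]) s.
Proof.
move=> [[eN eM e1] alv flg kv] deg0.
apply: (wp_for (n := m) (T := clk s + 40 * L) (Inv := fun k s' =>
  [/\ forall v : 'I_n, arr s' DEG v = #|[set e in in_edges H v | e < k]|,
     forall v : 'I_n, 0 < arr s' DEG v ->
       exists2 e, e \in in_edges H v & arr s' PTR v = src H e
   & clk s' <= clk s + 3 + 12 * k])) => //=.
- by lia.
- split=> [v|v|]; last by lia.
    by rewrite deg0; apply/esym/eqP; rewrite cards_eq0; apply/eqP/setP=> e; rewrite !inE ltn0 andbF.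
  by rewrite deg0.
- by move=> k s' le_k [_ _]; lia.
- move=> k s' lt_k [fv fa] ik [IHd IHp ck]; apply: vc_wp => /=.
  have e1' : var s' vOne = 1 by rewrite (fv vOne isT).
  pose e := Ordinal lt_k.
  have flge := flg e; rewrite -(fa FLG isT) /= in flge.
  rewrite ik e1' flge; vcs; split=> [|]; last first.
    case Ee: (e \in edges H) => // _; split=> //; last by lia.
    by move=> v; rewrite IHd card_lt_step inE Ee.
  case Ee: (e \in edges H) => // _.
  have [] := kv e Ee; rewrite -(fa KEY isT) -(fa VAL isT) /= => -> ->.
  have lt_d : arr s' DEG (tgt H e) <= m.
    by rewrite IHd -[X in _ <= X]card_ord max_card.
  have := ltn_ord (tgt H e) => lt_t; vcs.
  split; last by lia.
    move=> v; rewrite card_lt_step inE Ee /= -/e eq_sym -val_eqE /upd /=.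
    by case: eqP => [/val_inj->|_]; rewrite !IHd ?addn1.
  move=> v; rewrite /upd; case: eqP => [/val_inj-> _|_ /IHp //].
  by exists e; rewrite ?inE ?Ee ?eqxx.
move=> s' _ _ [IHd IHp c']; split=> // [v|]; last by lia.
by rewrite IHd; apply: eq_card => e; rewrite !inE ltn_ord andbT.
Qed.

Lemma mark_roots_correct H s : stores H s ->
  (forall v : 'I_n, [/\ arr s DEG v = #|in_edges H v|, arr s LAB v = 0
     & arr s VIS v = 0]) ->
  wp mark_roots (fun s' => (forall v : 'I_n, let b := #|in_edges H v| != 1 in
     [/\ arr s' ALV v = (v \in verts H) && b :> nat,
         arr s' LAB v = (if b then v.+1 else 0) & arr s' VIS v = b])
   /\ clk s' <= clk s + 40 * L) s.
Proof.
move=> [[eN eM e1] alv flg kv] dlv.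
apply: (wp_for (n := n) (T := clk s + 40 * L) (Inv := fun k s' =>
  (forall v : 'I_n, let b := (v < k) ==> (#|in_edges H v| != 1) in
     [/\ arr s' ALV v = (v \in verts H) && b :> nat,
         arr s' LAB v = (if (v < k) && b then v.+1 else 0)
       & arr s' VIS v = (v < k) && b])
   /\ clk s' <= clk s + 3 + 12 * k)) => //=.
- by lia.
- split; last by lia.
  by move=> v; have [_ -> ->] := dlv v; rewrite alv andbT.
- by move=> k s' le_k [_]; lia.
- move=> k s' lt_k [fv fa] + [IH ck].
  have e1' : var s' vOne = 1 by rewrite (fv vOne isT).
  have [v vk] : exists v : 'I_n, v = k :> nat by exists (Ordinal lt_k).
  subst k => ik; apply: vc_wp => /=.
  have [dv _ _] := dlv v; rewrite -(fa DEG isT) /= in dv.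
  have le_d : #|in_edges H v| < m.+1.
    by rewrite ltnS -[X in _ <= X]card_ord max_card.
  have [d ed] : exists d, d = #|in_edges H v| by eexists.
  rewrite -ed in dv le_d; rewrite ik e1' dv; vcs.
  have ltS (u : 'I_n) : u != v -> (u < v.+1) = (u < v).
    by rewrite -val_eqE /= ltnS leq_eqVlt => /negPf->.
  split=> d1; vcs; (split; last by lia) => u; rewrite /upd;
    case: (eqVneq u v) => [->|nuv] /=.
  - rewrite eqxx ltnSn /= -ed (_ : d != 1 = true); last by apply/eqP; lia.
    by have [-> _ _] := IH v; rewrite /= ltnn addn1.
  - by rewrite (negPf nuv : (u == v :> nat) = false) ltS.
  - rewrite -ed (_ : d = 1); last by lia.
    by have [_ -> ->] := IH v; rewrite eqxx ltnSn andbF /= ltnn.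
  - by rewrite (negPf nuv : (u == v :> nat) = false) ltS.
move=> s' _ _ [IH c']; split; last by lia.
by move=> v; have := IH v; rewrite ltn_ord.
Qed.

(** For [A] the array [VIS] this counts the unvisited vertices, the potential that pays for the
    climbs. *)
Definition zeros (A : nat -> nat) := #|[set x : 'I_n | A x == 0]|.

Lemma zeros_le A : zeros A <= n.
Proof. by rewrite -[X in _ <= X]card_ord max_card. Qed.

(** Amortised analysis: each unvisited vertex carries 14 credits. Pushing it costs 7 ticks with the
    loop test and sets aside 4 for its pop, so all climbs together are linear. *)
Lemma label_roots_correct H rk lab s :
    ranked rk H -> is_root_map H lab -> header s ->
    (forall v : 'I_n, let b := #|in_edges H v| != 1 in
       arr s LAB v = (if b then v.+1 else 0) /\ arr s VIS v = b) ->
    (forall v : 'I_n, #|in_edges H v| = 1 ->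
       exists2 e, e \in in_edges H v & arr s PTR v = src H e) ->
  wp label_roots (fun s' => (forall v : 'I_n, arr s' LAB v = (lab v).+1) /\
    clk s' <= clk s + 40 * L) s.
Proof.
move=> rkH [lab0 lab1] [eN eM e1] lv ptr.
(* An unvisited vertex has indegree 1, so a climb always has a parent to go to. *)
pose good s' := forall x : 'I_n,
  [/\ arr s' LAB x = 0 \/ arr s' LAB x = (lab x).+1, arr s' VIS x <= 1 &
      arr s' VIS x = 0 -> #|in_edges H x| = 1].
apply: (wp_for (n := n) (T := clk s + 40 * L) (Inv := fun k s' =>
  [/\ good s', forall x : 'I_n, arr s' VIS x = 1 -> arr s' LAB x <> 0,
      forall x : 'I_n, x < k -> arr s' VIS x = 1
    & clk s' + 14 * zeros (arr s' VIS) <= clk s + 3 + 14 * n + 12 * k])) => //=.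
- by lia.
- have le_u : zeros (arr s VIS) <= n.
    by apply: zeros_le.
  split=> //; last by lia.
    move=> x /=; have [-> ->] := lv x; split; try by case: eqP.
    by case: eqP => [|/eqP/lab0 ->]; [left | right].
  by move=> x; have [-> ->] := lv x; case: eqP.
- by move=> k s' le_k [_ _ _]; lia.
- move=> k s' lt_k [fv fa] ik [gd vl dn ck]; apply: vc_wp => /=.
  have e1' : var s' vOne = 1 by rewrite (fv vOne isT).
  have ptr' := fa PTR isT.
  pose v0 := Ordinal lt_k.
  rewrite ik e1' addn0; vcs.
  (* [stk] is the path climbed from [v0] to below [u]. Its vertices share the label of [v0] and have
     rank below that of [u]; hence [u] is not on it, and if [u] is visited, its label is already
     known. *)
  pose Inv s2 := exists (stk : seq 'I_n) (u : 'I_n),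
    [/\ [/\ var s2 vSp = size stk, var s2 vU = u,
            var s2 vC = 1 - arr s2 VIS u &
            forall i, i < size stk -> arr s2 STK i = nth u stk i],
        lab u = lab v0 /\ {in stk, forall x, lab x = lab v0 /\ rk x < rk u},
        good s2 /\ (forall x : 'I_n, arr s2 VIS x = 1 -> arr s2 LAB x <> 0 \/ x \in stk),
        (forall x : 'I_n, x < k -> arr s2 VIS x = 1) /\ (u = v0 \/ arr s2 VIS v0 = 1)
      & size stk + zeros (arr s2 VIS) <= n /\
        clk s2 + 14 * zeros (arr s2 VIS) + 4 * size stk <= clk s + 7 + 14 * n + 12 * k].
  apply: (@wp_while _ _ _ Inv (clk s + 40 * L)).
  - exists [::], v0; split=> //=.
    + by split=> // x /vl; left.
    + by split=> //; left.
    + have : zeros (arr s' VIS) <= n by apply: zeros_le.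
      by  lia.
  - by move=> s2 [stk [u [_ _ _ _ [_ ck2]]]]; lia.
  - move=> s2 [fv2 fa2] [stk [u [[esp eu ec est] [lu lstk] [gd2 vl2] [dn2 uv] [sz ck2]]]].
    move=> pos.
    have visu : arr s2 VIS u = 0 by lia.
    have [_ _ /(_ visu) deg1] := gd2 u.
    have [e] := ptr u deg1; rewrite inE => /andP[Ee /eqP te] pe.
    have lte := ltn_ord (src H e); have ltu := ltn_ord u.
    have u_in : u \in [set x : 'I_n | arr s2 VIS x == 0] by rewrite inE visu.
    have unvS : zeros (arr s2 VIS) = (zeros (upd (arr s2 VIS) u 1)).+1.
      rewrite /zeros (cardsD1 u) u_in; congr _.+1; apply: eq_card => x.
      by rewrite !inE /upd -val_eqE /=; case: eqP.
    apply: vc_wp => /=.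
    have -> : var s2 vOne = 1 by rewrite (fv2 vOne isT).
    rewrite esp eu; vcs.
    rewrite (fa2 PTR isT) /= ptr' pe; vcs.
    exists (rcons stk u), (src H e).
    rewrite size_rcons; split.
    + split=> //=; first by rewrite addn1.
      move=> i; rewrite ltnS leq_eqVlt /upd nth_rcons => /orP[/eqP->|lt_i].
        by rewrite eqxx ltnn.
      rewrite (ltn_eqF lt_i) lt_i est //.
      by congr val; apply: set_nth_default.
    + have lsu : lab (src H e) = lab v0.
        by rewrite -lab1 ?te // -te.
      have ru : rk u < rk (src H e) by rewrite -te; apply: rkH.
      split=> // x; rewrite mem_rcons inE => /orP[/eqP->//|/lstk[-> lt]].
      by split=> //; apply: ltn_trans ru.
    + split=> x /=; rewrite /upd.
        have [l1 v1 d1] := gd2 x; split=> //; case: eqP => //.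
      rewrite mem_rcons inE -val_eqE /=; case: eqP => /= [_ _|_ /vl2 //]; by right.
    + rewrite /= /upd; split=> [x lt_x|]; first by case: eqP => // _; apply: dn2.
      by case: eqP => [|ne]; right=> //; case: uv => // uv; case: ne; rewrite uv.
    + by rewrite /=; lia.
  move=> s2 [fv2 fa2] [stk [u [[esp eu ec est] [lu lstk] [gd2 vl2] [dn2 uv] [sz ck2]]]].
  move=> c0; have visu : arr s2 VIS u = 1 by have [_ ? _] := gd2 u; lia.
  have labu : arr s2 LAB u = (lab v0).+1.
    rewrite -lu; have [[z|//] _ _] := gd2 u.
    by have [/(_ z)//|/lstk[_]] := vl2 u visu; rewrite ltnn.
  have dnv : arr s2 VIS v0 = 1 by case: uv => [<-|].
  rewrite /= eu; split=> //; first by have := ltn_ord u; lia.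
  pose Inv2 s3 := [/\ var s3 vSp <= size stk, good s3,
      forall x : 'I_n, arr s3 VIS x = 1 ->
        arr s3 LAB x <> 0 \/ x \in take (var s3 vSp) stk
    & clk s3 + 14 * zeros (arr s3 VIS) + 4 * var s3 vSp <= clk s + 9 + 14 * n + 12 * k].
  apply: (@wp_while _ _ _ Inv2 (clk s + 40 * L)).
  - split=> //=; rewrite ?esp ?take_size // ; lia.
  - by move=> s3 [_ _ _]; lia.
  - move=> s3 [fv3 fa3] [le_sp gd3 vl3 ck3] pos.
    have e1'' : var s3 vOne = 1.
      by rewrite (fv3 vOne isT) /= (fv2 vOne isT) /= e1'.
    have [j ej] : exists j, var s3 vSp = j.+1 by exists (var s3 vSp).-1; lia.
    have lt_j : j < size stk by lia.
    have stj : arr s3 STK j = nth u stk j by rewrite (fa3 STK isT) /= est.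
    have lt_x := ltn_ord (nth u stk j).
    apply: vc_wp => /=; rewrite e1'' ej subn1 /= stj; vcs.
    have eA : var s3 vA = (lab v0).+1 by rewrite (fv3 vA isT) /= labu.
    have xin : nth u stk j \in stk by apply: mem_nth.
    rewrite eA; split=> /=.
    + exact: ltnW.
    + move=> x; rewrite /= /upd; have [l1 v1 d1] := gd3 x; split=> //.
      by case: eqP => [/val_inj->|//]; right; have [->] := lstk _ xin.
    + move=> x /vl3; rewrite ej (take_nth u) // mem_rcons inE /upd -val_eqE /=.
      by case: eqP => /= _; [left | case; [left | right]].
    + by move: ck3; rewrite ej; lia.
  move=> s3 [fv3 fa3] [le_sp gd3 vl3 ck3] z0.
  have eV : arr s3 VIS = arr s2 VIS by rewrite (fa3 VIS isT).
  split=> //=.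
  + by move=> x /vl3; rewrite z0 take0; case.
  + move=> x; rewrite ltnS leq_eqVlt eV => /orP[/eqP ek|/dn2 //].
    by rewrite (_ : x = v0) //; apply: val_inj.
  + by move: ck3; rewrite  z0; lia.
move=> s' _ _ [gd vl dn ck]; split; last by lia.
move=> x; have [[z|//] _ _] := gd x.
by have := vl x (dn x (ltn_ord x)); rewrite z.
Qed.

Lemma relabel_correct H H' (lab : 'I_n -> 'I_n) s : header s ->
    (forall e : 'I_m, arr s FLG e = (e \in edges H)) ->
    (forall e : 'I_m, e \in edges H ->
       arr s KEY e = tgt H e /\ arr s VAL e = src H e) ->
    (forall v : 'I_n, arr s DEG v = #|in_edges H v|) ->
    (forall v : 'I_n, arr s LAB v = (lab v).+1) ->
    edges H' = [set e in edges H | #|in_edges H (tgt H e)| != 1] ->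
    (forall e, e \in edges H' -> src H' e = lab (src H e)) ->
  wp relabel (fun s' => [/\ forall e : 'I_m, arr s' FLG e = (e \in edges H'),
     forall e : 'I_m, e \in edges H' -> arr s' VAL e = src H' e
   & clk s' <= clk s + 40 * L]) s.
Proof.
move=> [eN eM e1] flg kv deg labE eH' sH'.
apply: (wp_for (n := m) (T := clk s + 40 * L) (Inv := fun k s' =>
  [/\ forall e : 'I_m, arr s' FLG e =
        (e \in edges H) && ((e < k) ==> (e \in edges H')),
      forall e : 'I_m, e \in edges H -> k <= e -> arr s' VAL e = src H e,
      forall e : 'I_m, e \in edges H' -> e < k -> arr s' VAL e = src H' e
    & clk s' <= clk s + 3 + 16 * k])) => //=.
- by lia.
- split=> //; last by lia.
    by move=> e; rewrite flg andbT.
  by move=> e /kv[].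
- by move=> k s' le_k [_ _ _]; lia.
- move=> k s' lt_k [fv fa] + [IHf IHn IHo ck].
  have e1' : var s' vOne = 1 by rewrite (fv vOne isT).
  have [e ek] : exists e : 'I_m, e = k :> nat by exists (Ordinal lt_k).
  subst k => ik; apply: vc_wp => /=.
  have ltS (f : 'I_m) : f != e -> (f < e.+1) = (f < e).
    by rewrite -val_eqE /= ltnS leq_eqVlt => /negPf->.
  have geS (f : 'I_m) : e < f -> f != e /\ e <= f.
    by move=> lt_f; rewrite -val_eqE /= gtn_eqF // ltnW.
  have flge : arr s' FLG e = (e \in edges H) by rewrite IHf ltnn andbT.
  rewrite ik e1' flge; vcs; split=> [|]; last first.
    case Ee: (e \in edges H) => // _.
    have nEe : e \notin edges H' by rewrite eH' inE Ee.
    split=> // [f|f Ef /geS[_ le_f]|f Ef|]; last by lia.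
    - case: (eqVneq f e) => [->|nfe]; first by rewrite flge Ee.
      by rewrite IHf ltS.
    - exact: IHn.
    - case: (eqVneq f e) => [fe|nfe]; first by rewrite -fe Ef in nEe.
      by rewrite ltS //; apply: IHo.
  case Ee: (e \in edges H) => // _.
  have -> : arr s' KEY e = tgt H e by rewrite (fa KEY isT); case: (kv e Ee).
  have [d ed] : exists d, d = #|in_edges H (tgt H e)| by eexists.
  have le_d : d <= m by rewrite ed -[X in _ <= X]card_ord max_card.
  have -> : arr s' DEG (tgt H e) = d by rewrite (fa DEG isT) deg.
  have -> : arr s' VAL e = src H e by apply: IHn.
  have -> : arr s' LAB (src H e) = (lab (src H e)).+1 by rewrite (fa LAB isT).
  have lt_t := ltn_ord (tgt H e); have lt_s := ltn_ord (src H e).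
  vcs; split=> d1; vcs.
    have Ee' : e \in edges H' by rewrite eH' inE Ee -ed /=; apply/eqP; lia.
    split=> [f|f Ef /geS[nfe le_f]|f Ef|]; last by lia.
    - case: (eqVneq f e) => [->|nfe]; first by rewrite flge Ee Ee' implybT.
      by rewrite IHf ltS.
    - by rewrite /upd (negPf nfe : (f == e :> nat) = false); apply: IHn.
    - case: (eqVneq f e) => [->|nfe]; first by rewrite /upd eqxx sH' // subn1.
      by rewrite /upd (negPf nfe : (f == e :> nat) = false) ltS //; apply: IHo.
  have nEe : (e \in edges H') = false.
    by rewrite eH' inE Ee -ed (_ : d = 1) //; lia.
  split=> [f|f Ef /geS[nfe le_f]|f Ef|]; last by lia.
  - rewrite /upd; case: (eqVneq f e) => [->|nfe].
      by rewrite eqxx ltnSn nEe andbF d1.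
    by rewrite (negPf nfe : (f == e :> nat) = false) IHf ltS.
  - exact: IHn.
  - case: (eqVneq f e) => [fe|nfe]; first by rewrite -fe Ef in nEe.
    by rewrite ltS //; apply: IHo.
move=> s' _ _ [IHf _ IHo ck]; split=> [e|e Ee|]; last by lia.
  by rewrite IHf ltn_ord eH' inE; case: (e \in edges H).
by apply: IHo.
Qed.

Lemma swap_correct H s : stores H s ->
  wp swap (fun s' => stores (rev_graph H) s' /\ clk s' <= clk s + 40 * L) s.
Proof.
move=> [[eN eM e1] alv flg kv].
apply: (wp_for (n := m) (T := clk s + 40 * L) (Inv := fun k s' =>
  [/\ forall e : 'I_m, e \in edges H -> e < k ->
        arr s' KEY e = src H e /\ arr s' VAL e = tgt H e,
      forall e : 'I_m, e \in edges H -> k <= e ->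
        arr s' KEY e = tgt H e /\ arr s' VAL e = src H e
    & clk s' <= clk s + 3 + 16 * k])) => //=.
- by lia.
- by split=> //; [move=> e /kv[] | lia].
- by move=> k s' le_k [_ _]; lia.
- move=> k s' lt_k [fv fa] + [IHo IHn ck].
  have [e ek] : exists e : 'I_m, e = k :> nat by exists (Ordinal lt_k).
  subst k => ik; apply: vc_wp => /=; rewrite ik; vcs.
  split=> [f Ef lt_f|f Ef lt_f|]; last by lia.
    rewrite /upd; case: eqP => [/val_inj fe|nfe]; last by apply: IHo => //; lia.
    by have [] := IHn e; rewrite -?fe.
  by rewrite /upd gtn_eqF //; apply: IHn => //; apply: ltnW.
move=> s' [fv fa] _ [IHo _ ck]; split; last by lia.
split=> [|v|e|e Ee].
- by split; [rewrite (fv vN isT) | rewrite (fv vM isT) | rewrite (fv vOne isT)].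
- by rewrite (fa ALV isT) alv.
- by rewrite (fa FLG isT) flg.
- exact: IHo.
Qed.

(** [label_roots] computes the root map, [relabel] applies it, and [contract_all_inP] identifies the
    outcome. Five passes of at most [40 * L] give the bound. *)
Lemma contract_correct H o rk s :
    stores H s -> closed_graph H -> ranked rk H ->
    uniq o -> {subset verts H <= o} ->
  wp contract (fun s' => stores (contract_all_in H o) s' /\
    clk s' <= clk s + 200 * L) s.
Proof.
move=> sH clH rkH uo so; have [lab labP] := root_map_exists rkH.
have [vH' eH' tH' sH' _] := contract_all_inP clH rkH labP uo so.
set H' := contract_all_in H o in vH' eH' tH' sH' *.
have [hd alv flg kv] := sH.
apply: wp_seq; apply: wp_conseq (clear_correct hd) _ => s1 F1 [z1 c1].
have [fv1 fa1] := F1.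
have sH1 : stores H s1.
  have [eN eM e1] := hd; split.
  - by split; [rewrite (fv1 vN isT) | rewrite (fv1 vM isT) | rewrite (fv1 vOne isT)].
  - by rewrite (fa1 ALV isT).
  - by rewrite (fa1 FLG isT).
  - by rewrite (fa1 KEY isT) (fa1 VAL isT).
apply: wp_seq; apply: wp_conseq (count_in_correct sH1 _) _ => [v|s2 [fv2 fa2] [d2 p2 c2]].
  by have [] := z1 v.
have sH2 : stores H s2.
  have [[eN eM e1] alv1 flg1 kv1] := sH1; split.
  - by split; [rewrite (fv2 vN isT) | rewrite (fv2 vM isT) | rewrite (fv2 vOne isT)].
  - by rewrite (fa2 ALV isT).
  - by rewrite (fa2 FLG isT).
  - by rewrite (fa2 KEY isT) (fa2 VAL isT).
apply: wp_seq; apply: wp_conseq (mark_roots_correct sH2 _) _ => [v|s3 [fv3 fa3] [r3 c3]].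
  by rewrite (fa2 LAB isT) (fa2 VIS isT); have [] := z1 v.
have hd3 : header s3.
  have [[eN eM e1] _ _ _] := sH2.
  by split; [rewrite (fv3 vN isT) | rewrite (fv3 vM isT) | rewrite (fv3 vOne isT)].
apply: wp_seq; apply: wp_conseq (label_roots_correct rkH labP hd3 _ _) _ => [v|v d1|].
- by have [] := r3 v.
- by rewrite (fa3 PTR isT); apply: p2; rewrite d2 d1.
move=> s4 [fv4 fa4] [l4 c4].
have hd4 : header s4.
  have [eN eM e1] := hd3.
  by split; [rewrite (fv4 vN isT) | rewrite (fv4 vM isT) | rewrite (fv4 vOne isT)].
have [_ _ flg2 kv2] := sH2.
apply: wp_conseq (relabel_correct (H := H) (H' := H') hd4 _ _ _ l4 eH' sH') _ => [e|e Ee|v|].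
- by rewrite (fa4 FLG isT) (fa3 FLG isT).
- by rewrite (fa4 KEY isT) (fa3 KEY isT) (fa4 VAL isT) (fa3 VAL isT); apply: kv2.
- by rewrite (fa4 DEG isT) (fa3 DEG isT).
move=> s5 [fv5 fa5] [f5 v5 c5]; split; last by lia.
split=> //.
- have [eN eM e1] := hd4.
  by split; [rewrite (fv5 vN isT) | rewrite (fv5 vM isT) | rewrite (fv5 vOne isT)].
- move=> v; rewrite (fa5 ALV isT) (fa4 ALV isT) vH' inE.
  by have [] := r3 v.
- move=> e He; split; last exact: v5.
  rewrite (fa5 KEY isT) (fa4 KEY isT) (fa3 KEY isT) tH'.
  by move: He; rewrite eH' inE => /andP[/kv2[]].
Qed.

(** After the second contraction the store holds the reverse of the reduced graph, so that [KEY] is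
    the source and [VAL] the target of an edge of [G]. *)
Lemma build_correct G s : stores (rev_graph G) s ->
    (forall v : 'I_n, arr s NSR v = 0 /\ arr s HED v = 0) ->
  wp build (fun s' => [/\ forall v : 'I_n, arr s' NSR v = (in_edges G v != set0),
     exists adj : 'I_n -> seq 'I_m, forall u, [/\ uniq (adj u),
       adj u =i out_edges G u & linked (arr s' LNK) (arr s' HED u) (adj u)]
   & clk s' <= clk s + 40 * L]) s.
Proof.
move=> [[eN eM e1] alv flg kv] z0; rewrite /= in flg kv.
apply: (wp_for (n := m) (T := clk s + 40 * L) (Inv := fun k s' =>
  [/\ forall v : 'I_n, arr s' NSR v = [exists e in in_edges G v, e < k],
     forall u : 'I_n, exists es : seq 'I_m, [/\ uniq es,
       forall e, (e \in es) = (e \in out_edges G u) && (e < k) &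
       linked (arr s' LNK) (arr s' HED u) es]
   & clk s' <= clk s + 3 + 16 * k])) => //=.
- by lia.
- split=> [v|u|]; last by lia.
    have [-> _] := z0 v; case: exists_inP => // [[e _]]; by rewrite ltn0.
  exists [::]; split=> // [e|]; first by rewrite ltn0 andbF.
  by have [] := z0 u.
- by move=> k s' le_k [_ _]; lia.
- move=> k s' lt_k [fv fa] + [IHn IHl ck].
  have e1' : var s' vOne = 1 by rewrite (fv vOne isT).
  have [e ek] : exists e : 'I_m, e = k :> nat by exists (Ordinal lt_k).
  subst k => ik; apply: vc_wp => /=.
  have ltS (f : 'I_m) : (f < e.+1) = (f == e) || (f < e).
    by rewrite -val_eqE /= ltnS leq_eqVlt.
  have flge : arr s' FLG e = (e \in edges G) by rewrite (fa FLG isT) flg.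
  rewrite ik e1' flge; vcs; split=> [|]; last first.
    case Ee: (e \in edges G) => // _.
    split=> [v|u|]; last by lia.
      rewrite IHn; congr nat_of_bool; apply: eq_existsb => f.
      by rewrite ltS !inE; case: (f =P e) => // ->; rewrite Ee.
    have [es [ues ces les]] := IHl u; exists es; split=> // f.
    by rewrite ces ltS !inE; case: (f =P e) => // ->; rewrite Ee.
  case Ee: (e \in edges G) => // _.
  have [] := kv e Ee; rewrite -(fa KEY isT) -(fa VAL isT) /= => -> ->.
  have lt_t := ltn_ord (tgt G e); have lt_s := ltn_ord (src G e).
  vcs; split=> [v|u|]; last by lia.
    rewrite /upd; case: eqP => [/val_inj->|ne].
      case: exists_inP => // [[]]; exists e; rewrite ?ltnSn //.
      by rewrite inE Ee eqxx.
    rewrite IHn; congr nat_of_bool; apply: eq_existsb => f.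
    rewrite ltS !inE; case: (f =P e) => // ->.
    rewrite ltnn andbF (_ : (tgt G e == v) = false) ?andbF //.
    by apply/eqP=> tv; rewrite tv in ne.
  have [es [ues ces les]] := IHl u.
  have ne : e \notin es by rewrite ces ltnn andbF.
  case: (src G e =P u) => [su|nsu].
    exists (e :: es); split=> /=; first by rewrite ne.
      move=> f; rewrite inE ces ltS !inE; case: (f =P e) => // ->.
      by rewrite Ee su eqxx.
    rewrite {1}/upd su eqxx addn1; split=> //.
    by rewrite /upd eqxx; apply: linked_upd.
  exists es; split=> // [f|].
    rewrite ces ltS !inE; case: (f =P e) => // ->.
    by rewrite (_ : (src G e == u) = false) ?andbF //; apply/eqP.
  rewrite {2}/upd; case: eqP => [/val_inj eu|_]; first by rewrite eu in nsu.
  exact: linked_upd.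
move=> s' _ _ [IHn IHl ck]; split; last by lia.
  move=> v; rewrite IHn; congr nat_of_bool.
  apply/exists_inP/set0Pn => [[e Ee _]|[e Ee]]; exists e => //.
apply: (fin_all_exists (P := fun u es => [/\ uniq es, es =i out_edges G u &
  linked (arr s' LNK) (arr s' HED u) es])) => u.
have [es [ues ces les]] := IHl u; exists es; split=> // e.
by rewrite ces ltn_ord andbT.
Qed.

(** * Correctness and cost of the breadth-first searches *)

Section Search.
Variables (G : digraph 'I_n 'I_m) (adj : 'I_n -> seq 'I_m).
Hypothesis closedG : closed_graph G.
Hypothesis outG : {in verts G, forall v, #|out_edges G v| != 1}.
Hypothesis adjP : forall u, uniq (adj u) /\ adj u =i out_edges G u.

Definition adjacency s := [/\ header s,
  forall e : 'I_m, e \in edges G -> arr s VAL e = tgt G e &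
  forall u : 'I_n, linked (arr s LNK) (arr s HED u) (adj u)].

(** [es] lists the edges by which vertices were discovered, in order of discovery. *)
Definition queue (r : 'I_n) (es : seq 'I_m) : seq 'I_n := r :: map (tgt G) es.

(** [h] vertices have left the queue and [D] describes the edges scanned. The last clause says that
    every scanned edge discovered a new vertex, that is, that no collision has occurred. *)
Definition explored (r : 'I_n) (es : seq 'I_m) h (D : pred 'I_m) s :=
  [/\ [/\ var s vTl = size (queue r es), h <= size (queue r es) &
          forall i, i < size (queue r es) -> arr s QUE i = nth r (queue r es) i],
      [/\ uniq (queue r es),
          forall x : 'I_n, (arr s MRK x == r.+1) = (x \in queue r es) &
          forall x, x \in queue r es -> reach G r x] &
      forall e, (e \in es) = (e \in edges G) && D e].

(** Either no collision has occurred, and the cost is charged to dequeued vertices and tree edges,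
    or one has refuted [in_tree], and the cost is linear in [n] since the queue never repeats a
    vertex. *)
Definition bfs_inv (r : 'I_n) c0 s :=
  (forall x : 'I_n, arr s MRK x <= r.+1) /\
  ([/\ var s vOk = 1 & exists es : seq 'I_m,
      [/\ explored r es (var s vHd)
            (fun e => src G e \in take (var s vHd) (queue r es)) s,
          var s vQ = size (queue r es) - var s vHd &
          clk s <= c0 + 10 * var s vHd + 14 * size es]]
   \/ [/\ var s vOk = 0, var s vQ = 0, ~ in_tree G r & clk s <= c0 + 30 * n + 30]).

Lemma size_queue r es : uniq (queue r es) -> size (queue r es) <= n.
Proof. by move=> /card_uniqP <-; rewrite -[X in _ <= X]card_ord max_card. Qed.

(** An edge into a vertex already queued has the same target as the tree edge that discovered that
    vertex; the root, being a source, is ruled out as target. Both edges are reachable from [r] and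
    they differ, which contradicts [in_tree]. *)
Lemma scan_vertex_correct r (es : seq 'I_m) c0 s :
    r \in sources G -> adjacency s -> var s vS = r.+1 -> var s vOk = 1 ->
    var s vHd < size (queue r es) ->
    (forall x : 'I_n, arr s MRK x <= r.+1) ->
    explored r es (var s vHd)
      (fun e => src G e \in take (var s vHd) (queue r es)) s ->
    clk s <= c0 + 10 * var s vHd + 14 * size es + 1 ->
  wp scan_vertex (bfs_inv r c0) s.
Proof.
move=> Sr [[eN eM e1] val lnk] eS eOk lt_h mrk [[eTl _ que] [uq mq rq] eD] ck.
have [h eh] : exists h, h = var s vHd by eexists.
rewrite -eh in lt_h eD ck.
have [u eu] : exists u, u = nth r (queue r es) h by eexists.
have szq := size_queue uq; have ltu := ltn_ord u; have ltr := ltn_ord r.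
have [uadj cadj] := adjP u.
apply: vc_wp => /=.
rewrite -eh que // -eu; split=> //; first by lia.
rewrite e1; split; first by lia.
split=> //; first by lia.
(* [rest] is the part of the adjacency list of [u] still to be scanned. *)
pose Inv s2 := (forall x : 'I_n, arr s2 MRK x <= r.+1) /\
  ([/\ var s2 vOk = 1 & exists (es : seq 'I_m) (rest : seq 'I_m),
      [/\ explored r es h (fun e => (src G e \in take h (queue r es)) ||
            (src G e == u) && (e \notin rest)) s2,
          [/\ h < size (queue r es), nth r (queue r es) h = u,
              linked (arr s2 LNK) (var s2 vL) rest, uniq rest &
              {subset rest <= out_edges G u}] &
          clk s2 <= c0 + 10 * h + 14 * size es + 4]]
   \/ [/\ var s2 vOk = 0, var s2 vL = 0, ~ in_tree G r &
          clk s2 <= c0 + 30 * n + 24]).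
apply: (@wp_while _ _ _ Inv (c0 + 40 * L)).
- split=> //; left; split=> //; exists es, (adj u); split=> /=; last by lia.
    split=> //; first by split=> //; apply: ltnW.
    move=> e; rewrite eD; case Ee: (e \in edges G) => //=.
    by rewrite cadj inE Ee andbN orbF.
  by split=> // e; rewrite cadj.
- move=> s2 [_ [[_ [es2 [rest [[_ [/size_queue sz _ _] _] [lt2 _ _ _ _] ck2]]]]|[_ _ _ ck2]]];
    last by lia.
  by move: sz lt2; rewrite /= size_map; lia.
- move=> s2 [fv2 fa2] [mrk2 [|[_ -> //]]] [eOk2 [es2 [rest [ex2 [lt2 nth2 lnk2 urest srest] ck2]]]].
  case: rest lnk2 urest srest ex2 => [-> //|e rest] /= [eL lnk2] /andP[ne urest] srest.
  move=> [[eTl2 le2 que2] [uq2 mq2 rq2] eD2] _.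
  have szq2 := size_queue uq2.
  have : e \in out_edges G u by apply: srest; rewrite mem_head.
  rewrite inE => /andP[Ee /eqP se].
  have e12 : var s2 vOne = 1 by rewrite (fv2 vOne isT).
  have eS2 : var s2 vS = r.+1 by rewrite (fv2 vS isT).
  have val2 : arr s2 VAL e = tgt G e by rewrite (fa2 VAL isT) /= val.
  have lte : e < L by have := ltn_ord e; clear; lia.
  have ltt : tgt G e < L by have := ltn_ord (tgt G e); clear; lia.
  have ltB : arr s2 MRK (tgt G e) - r.+1 + (r.+1 - arr s2 MRK (tgt G e)) < B.
    by have := mrk2 (tgt G e); clear -L_le ltr; lia.
  have u_in : u \in queue r es2 by rewrite -nth2 mem_nth.
  (* [u] sits in the queue only at position [h], so its edges are not among those counted for
     earlier vertices and [e] is new. *)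
  have u_nin : u \notin take h (queue r es2).
    move: uq2; rewrite -{1}(cat_take_drop h (queue r es2)) cat_uniq.
    case/and3P=> _ /hasPn + _; apply.
    by rewrite -nth2 (drop_nth r lt2) mem_head.
  have e_nin : e \notin es2.
    by rewrite eD2 Ee se eqxx mem_head orbF.
  have re : reach G r (src G e) by rewrite se; apply: rq2.
  apply: vc_wp => /=.
  rewrite e12 eS2 eL subn1 /= val2.
  split=> //; split=> //; split=> //; split=> dif; last first.
    split; first by clear -L_le; lia.
    split; first by clear -L_le; lia.
    split=> //; right; split=> //=; last first.
      by move: szq2 lt2 ck2; rewrite /= size_map; clear; lia.
    (* The collision: the discovering edge [f] lies in [es], whereas [e] does not. *)
    move=> tree.
    have : tgt G e \in queue r es2 by rewrite -mq2; apply/eqP; clear -dif; lia.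
    rewrite inE (negPf (source_no_edge Sr Ee)) /= => /mapP[f f_in tef].
    have Ef : f \in edges G by move: f_in; rewrite eD2 => /andP[].
    have rf : reach G r (src G f).
      apply: rq2; move: f_in; rewrite eD2 => /andP[_ /orP[/mem_take //|]].
      by case/andP=> /eqP->.
    by move: e_nin; rewrite (tree e f) // f_in.
  have w_nin : tgt G e \notin queue r es2.
    by rewrite -mq2; apply/eqP; clear -dif; lia.
  have q2 : queue r (rcons es2 e) = rcons (queue r es2) (tgt G e).
    by rewrite /queue map_rcons.
  have uq2' : uniq (queue r (rcons es2 e)) by rewrite q2 rcons_uniq w_nin.
  have szq2' := size_queue uq2'; rewrite q2 size_rcons in szq2'.
  rewrite eTl2; split=> //; split=> //.
    by clear -szq2'; lia.
  split; first by clear -szq2' L_le; lia.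
  split=> //; split.
    move=> x; rewrite /= /upd; case: eqP => // _; exact: mrk2.
  left; split=> //; exists (rcons es2 e), rest; split.
  + rewrite /explored q2 size_rcons; split=> /=.
    * split=> [||i]; [by rewrite addn1 | exact: ltnW |].
      rewrite ltnS leq_eqVlt /upd -[r :: rcons _ _]/(rcons (queue r es2) _) nth_rcons.
      case/orP=> [/eqP->|lt_i]; first by rewrite eqxx ltnn.
      by rewrite (ltn_eqF lt_i) lt_i que2.
    * split; first by rewrite q2 in uq2'.
        move=> x; rewrite /upd -[r :: rcons _ _]/(rcons (queue r es2) _) mem_rcons inE -mq2 -val_eqE /=.
        by case: (nat_of_ord x =P tgt G e) => _; rewrite ?eqxx.
      move=> x; rewrite -[r :: rcons _ _]/(rcons (queue r es2) _) mem_rcons inE.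
      case/orP=> [/eqP->|/rq2 //].
      exact: reach_step.
    * move=> f; rewrite mem_rcons inE eD2 -[r :: rcons _ _]/(rcons (queue r es2) _) 
        -[rcons (queue _ _) _]cats1 takel_cat //.
      case: (f =P e) => [->|nfe] /=.
        by rewrite Ee se eqxx ne orbT.
      by rewrite inE negb_or (_ : f == e = false) //; apply/eqP.
  + rewrite q2 size_rcons nth_rcons lt2; split=> //; try exact: ltnW lt2.
    by move=> f fr; apply: srest; rewrite inE fr orbT.
  + by rewrite size_rcons /=; clear -ck2; lia.
move=> s2 [fv2 fa2] [mrk2 [[eOk2 [es2 [rest [ex2 [lt2 nth2 lnk2 urest srest] ck2]]]]|[eOk2 eL2 ntree ck2]]] z2.
  have rest0 : rest = [::] by case: rest lnk2 {ex2 urest srest} => //= e rest []; rewrite z2.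
  subst rest; move: ex2 => [[eTl2 le2 que2] [uq2 mq2 rq2] eD2].
  have eH : var s2 vHd = h.+1 by rewrite (fv2 vHd isT) /= addn1.
  rewrite /= eOk2; split=> // _; split=> //=; left; split=> //.
  exists es2; rewrite [var _ vHd]/= eH; split=> //; last by rewrite /=; lia.
    split=> //; move=> f.
    by rewrite eD2 (take_nth r lt2) mem_rcons inE nth2 /= andbT orbC.
  by rewrite eTl2 /=.
rewrite /= eOk2; split=> // _.
split; first by lia.
split=> //=; right; split=> //=; lia.
Qed.

(* The discovered edges form a tree in which every inner vertex has at least two
   children, so its size is linear in the number of its leaves. *)
Lemma explored_all r es s :
    r \in sources G ->
    explored r es (size (queue r es))
      (fun e => src G e \in take (size (queue r es)) (queue r es)) s ->
  in_tree G r /\ (size es).+1 <= 2 * #|sinks G|.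
Proof.
rewrite take_size => Sr [_ [uq _ _] eD].
have Vr : r \in verts G by move: Sr; rewrite inE => /andP[].
have ut : uniq (map (tgt G) es) by case/andP: uq.
(* A queue that has been processed entirely is closed under outgoing edges. *)
have reach_in x : reach G r x -> x \in queue r es.
  case=> p; elim/last_ind: p x => [|p e IHp] x.
    by move/eqP <-; rewrite mem_head.
  rewrite walk_rcons => /and3P[/IHp se Ee /eqP <-].
  by rewrite inE map_f ?orbT // eD Ee.
split.
  move=> e f Ee Ef /reach_in re /reach_in rf.
  by apply: (uniq_map_inj ut); rewrite eD ?Ee ?Ef.
have cQ : #|[set x in queue r es]| = (size es).+1.
  rewrite -(size_map (tgt G)) -[RHS]/(size (queue r es)) -(card_uniqP uq).
  by apply: eq_card => x; rewrite inE.
rewrite -cQ; apply: tree_size => //; last rewrite cQ.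
  apply/subsetP=> x; rewrite !inE => /predU1P[->//|/mapP[e]].
  by rewrite eD => /andP[/closedG/andP[_ Vt] _] ->.
congr _.+1; rewrite -(card_uniqP (map_uniq ut)).
by apply: eq_card => e; rewrite !inE eD inE.
Qed.

(** Earlier searches left stamps of at most [r], so nothing carries the stamp [r + 1] at the start.
    A completed search costs at most 24 ticks per vertex of a tree with at most [2 * t] vertices, up
    to a constant, where [t] is the number of sinks. *)
Lemma bfs_correct (r : 'I_n) s :
    r \in sources G -> adjacency s -> var s vI = r -> var s vOk = 1 ->
    (forall x : 'I_n, arr s MRK x <= r) ->
  wp bfs (fun s' => (forall x : 'I_n, arr s' MRK x <= r.+1) /\
    ([/\ var s' vOk = 1, in_tree G r & clk s' <= clk s + 60 * #|sinks G| + 20]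
     \/ [/\ var s' vOk = 0, ~ in_tree G r & clk s' <= clk s + 30 * n + 40])) s.
Proof.
move=> Sr [hd val lnk] eI eOk mrk; have [eN eM e1] := hd.
have ltr := ltn_ord r.
apply: vc_wp => /=; rewrite eI e1 addn1; vcs.
apply: (@wp_while _ _ _ (bfs_inv r (clk s + 6)) (clk s + 6 + 40 * L)).
- split=> /=.
    by move=> x; rewrite /upd; case: eqP => // _; apply: leqW.
  left; split=> //; exists [::]; split=> //=; last by lia.
  split=> //=.
  + by split=> // i; rewrite ltnS leqn0 => /eqP->; rewrite /upd eqxx.
  + split=> //= x; rewrite inE.
      rewrite -val_eqE /upd /=; case: (nat_of_ord x =P r) => _.
        by rewrite eqxx.
      by apply/eqP; have := mrk x; lia.
    by move/eqP->; apply: reach_refl.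
  + by move=> e; rewrite andbF.
- move=> s2 [_ [[_ [es [[[_ le_h _] [/size_queue sz _ _] _] _ ck]]]|[_ _ _ ck]]]; last by lia.
  by move: sz le_h; rewrite /= size_map; lia.
- move=> s2 [fv2 fa2] [mrk2 [[eOk2 [es [ex2 eQ ck2]]]|[_ -> //]]] pos.
  apply: (scan_vertex_correct (es := es)) => //=.
  + split.
    * by split; [rewrite (fv2 vN isT) | rewrite (fv2 vM isT) | rewrite (fv2 vOne isT)].
    * by rewrite /= (fa2 VAL isT).
    * by rewrite /= (fa2 LNK isT) (fa2 HED isT).
  + by rewrite (fv2 vS isT).
  + by move: eQ pos => /=; lia.
  + by rewrite addn1.
move=> s2 _ [mrk2 [[eOk2 [es [ex2 eQ ck2]]]|[eOk2 eQ ntree ck2]]] z2; split=> //=.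
  left; have [[_ le_h _] _ _] := ex2.
  have eh : var s2 vHd = size (queue r es) by rewrite z2 in eQ; lia.
  rewrite eh in ex2; have [tree sz] := explored_all Sr ex2.
  split=> //; move: ck2; rewrite eh /= size_map.
  by move: #|sinks G| sz => k; lia.
by right; split=> //; lia.
Qed.

(** Completed searches are charged [60 * t] to their source, for [t] sinks. At most one search
    fails, since none starts afterwards, and its cost is linear in [n]. *)
Lemma search_correct s :
    adjacency s ->
    (forall v : 'I_n, arr s ALV v = (v \in verts G)) ->
    (forall v : 'I_n, arr s NSR v = (in_edges G v != set0)) ->
    (forall x : 'I_n, arr s MRK x = 0) ->
  wp search (fun s' => exists2 ok : bool, var s' vOk = ok &
    (ok <-> forall r, r \in sources G -> in_tree G r) /\
    clk s' <= clk s + 60 * (#|sources G| * #|sinks G|) + 120 * L) s.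
Proof.
move=> [[eN eM e1] val lnk] alv nsr mrk.
apply: wp_seq; apply: vc_wp => /=; split; first by lia.
set t := #|sinks G|.
pose srcs k := #|[set r in sources G | r < k]|.
have srcs_le k : srcs k <= #|sources G|.
  by apply: subset_leq_card; apply/subsetP=> x; rewrite inE => /andP[].
have [f fE] : exists f, forall k, f k = srcs k by exists srcs.
have [S sE] : exists S, S = #|sources G| by eexists.
have f_le k : f k <= S by rewrite fE sE.
have [t' tE] : exists t', t' = t by eexists.
rewrite -sE -tE.
apply: (wp_for (n := n) (T := clk s + 60 * (S * t') + 120 * L) (Inv := fun k s' =>
  (forall x : 'I_n, arr s' MRK x <= k) /\
  ([/\ var s' vOk = 1, forall r, r \in sources G -> r < k -> in_tree G r &
       clk s' <= clk s + 4 + 40 * k + 60 * (f k * t')]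
   \/ [/\ var s' vOk = 0, exists2 r, r \in sources G & ~ in_tree G r &
       clk s' <= clk s + 44 + 40 * k + 60 * (S * t') + 30 * n]))) => //=.
- by lia.
- split=> [x|]; first by rewrite mrk.
  by left; split=> //; lia.
- move=> k s' le_k [_ [[_ _ ck]|[_ _ ck]]]; last by lia.
  have : f k * t' <= S * t' by rewrite leq_mul2r f_le orbT.
  by lia.
- move=> k s' lt_k [fv fa] + [mrk' Inv].
  have [r rk] : exists r : 'I_n, r = k :> nat by exists (Ordinal lt_k).
  subst k => eI.
  have e1' : var s' vOne = 1 by rewrite (fv vOne isT).
  have ltr := ltn_ord r.
  have fS : f r.+1 = (r \in sources G) + f r.
    rewrite !fE /srcs (card_lt_step _ lt_k) (_ : Ordinal lt_k = r) //.
    exact: val_inj.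
  have Sr : (r \in sources G) = (r \in verts G) && (in_edges G r == set0).
    by rewrite inE.
  have nsrc : arr s' ALV r - arr s' NSR r = (r \in sources G).
    rewrite (fa ALV isT) (fa NSR isT) /= alv nsr Sr.
    by case: (r \in verts G); case: (_ == set0).
  have ltS (x : 'I_n) : (x < r.+1) = (x == r) || (x < r).
    by rewrite -val_eqE /= ltnS leq_eqVlt.
  have ltL : r < L by lia.
  do 3!(apply: wp_seq; apply: vc_wp => /=; rewrite ?eI; try split=> //).
  rewrite nsrc; apply: wp_seq; apply: vc_wp => /=.
  case: Inv => [[eOk IHt ck]|[eOk IHt ck]]; rewrite eOk; split=> // _.
    apply: wp_if => /=; last first.
      move=> Sr0; apply: vc_wp; split=> [x|]; first exact/leqW/mrk'.
      left; split=> //; last by rewrite fS Sr0 /=; lia.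
      move=> x Sx; rewrite ltS => /predU1P[ex|/(IHt _ Sx) //].
      by rewrite ex in Sx; rewrite Sx in Sr0.
    move=> Sr1; have {}Sr1 : r \in sources G by case: (r \in _) Sr1.
    apply: wp_conseq (bfs_correct Sr1 _ _ _ _) _ => //.
      split=> /=.
      + by split=> /=; [rewrite (fv vN isT) | rewrite (fv vM isT) | rewrite (fv vOne isT)].
      + by rewrite (fa VAL isT).
      + by rewrite (fa LNK isT) (fa HED isT).
    move=> s2 _ [mrk2 [[eOk2 tree ck2]|[eOk2 ntree ck2]]]; split=> //=.
      left; split=> //=.
        move=> x Sx; rewrite ltS => /predU1P[-> //|/(IHt _ Sx) //].
      by rewrite fS Sr1 mulnDl mul1n; move: ck2; rewrite -/t -tE /=; lia.
    right; split=> //=; first by exists r.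
    have : f r * t' <= S * t' by rewrite leq_mul2r f_le orbT.
    by move: ck2 => /=; lia.
  split; first by lia.
  apply: wp_if => //= _; apply: vc_wp; split=> [x|]; first exact/leqW/mrk'.
  by right; split=> //=; lia.
move=> s' _ _ [_ [[eOk tree ck]|[eOk [r Sr ntree] ck]]].
  exists true => //; split; first by split=> // _ r Sr; apply: tree.
  have : f n * t' <= S * t' by rewrite leq_mul2r f_le orbT.
  by lia.
exists false => //; split; first by split=> // tree; case: ntree; apply: tree.
by lia.
Qed.

End Search.

(** The bound on [n] is what later turns time linear in [n + m] into time linear in [s * t + m]. The
    stages cost 20, 200, 40, 200, 40 and 120 times [L], within the allowance of 700. *)
Lemma test_reduced_correct (a b : 'I_m -> 'I_n) Gr R0 :
    inp 0 = n -> inp 1 = m ->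
    (forall e : 'I_m, inp (e + e + 2) = a e) ->
    (forall e : 'I_m, inp (e + e + 2 + 1) = b e) ->
    reduced (input_graph a b) Gr ->
  exists ok : bool,
    [/\ ok <-> singly_connected Gr, n <= 2 * m + #|sources Gr| * #|sinks Gr| &
    wp test_reduced (fun s => var s vOk = ok /\
        clk s <= 60 * (#|sources Gr| * #|sinks Gr|) + 700 * L)
      (HSt R0 (fun _ _ => 0) 0)].
Proof.
move=> i0 i1 ia ib [o1 [o2]]; set G := input_graph a b.
set H1 := contract_all_in G o1 => -[[po1 lt1] [po2 lt2] ->].
have clG : closed_graph G by move=> e _; rewrite !inE.
have rkG : ranked (index^~ o1) G by [].
have uo1 : uniq o1 by rewrite (perm_uniq po1) enum_uniq.
have so1 : {subset verts G <= o1} by move=> v Gv; rewrite (perm_mem po1) mem_enum.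
have /= := contract_all_in_props clG rkG uo1 so1; rewrite -/H1 => -[cl1 _ _ iso1].
have cl1' : closed_graph (rev_graph H1) by move=> e /cl1; rewrite andbC.
have rk1 : ranked (index^~ o2) (rev_graph H1) by [].
have uo2 : uniq o2 by rewrite (perm_uniq po2) enum_uniq.
have so2 : {subset verts (rev_graph H1) <= o2}.
  by move=> v Gv; rewrite (perm_mem po2) mem_enum.
have /= := contract_all_in_props cl1' rk1 uo2 so2.
rewrite contract_all_out_rev; set K := contract_all_in _ o2 => -[clK rkK outK isoK].
have clR : closed_graph (rev_graph K) by move=> e /clK; rewrite andbC.
have revK : rev_graph (rev_graph K) = K by case: K {clK rkK outK isoK clR}.
have rkR : ranked (index^~ o2) (rev_graph (rev_graph K)) by rewrite revK.
have le_n : n <= 2 * m + #|sources (rev_graph K)| * #|sinks (rev_graph K)|.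
  (* An isolated vertex is both a source and a sink of the reduced graph, so their number is at most
     [s] and at most [t], hence at most [s * t]. All other vertices are among the [2 * m] ends of
     edges. *)
  pose iso := [set v | (in_edges G v == set0) && (out_edges G v == set0)].
  have isoP v : v \in iso -> v \in sources (rev_graph K) /\ v \in sinks (rev_graph K).
    rewrite inE => /andP[/eqP in0 /eqP out0].
    have [v1 in1 out1] := iso1 v (in_setT v) in0 out0.
    have [v2 in2 out2] := isoK v v1 out1 in1.
    by rewrite [v \in sources _]inE [v \in sinks _]inE -[in_edges _ _]/(out_edges K v)
         -[out_edges (rev_graph _) _]/(in_edges K v) in2 out2 eqxx v2.
  have le_src : #|iso| <= #|sources (rev_graph K)|.
    by apply: subset_leq_card; apply/subsetP=> v /isoP[].
  have le_snk : #|iso| <= #|sinks (rev_graph K)|.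
    by apply: subset_leq_card; apply/subsetP=> v /isoP[].
  have le_iso : #|iso| <= #|sources (rev_graph K)| * #|sinks (rev_graph K)|.
    apply: leq_trans (leq_mul le_src le_snk).
    by case: #|iso| => // k; rewrite leq_pmulr.
  have cov : [set: 'I_n] \subset iso :|: (a @: setT :|: b @: setT).
    apply/subsetP=> v _; rewrite !inE.
    case: (set_0Vmem (in_edges G v)) => [->|[e]]; last first.
      rewrite !inE /= => /eqP <-; apply/orP; right; apply/orP; right.
      by apply: imset_f; rewrite inE.
    case: (set_0Vmem (out_edges G v)) => [->|[e]]; first by rewrite eqxx.
    rewrite !inE /= => /eqP <-; apply/orP; right; apply/orP; left.
    by apply: imset_f; rewrite inE.
  have := subset_leq_card cov; rewrite cardsT card_ord => le1.
  have le2 : #|iso :|: (a @: setT :|: b @: setT)| <= #|iso| + (m + m).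
    apply: leq_trans (leq_card_setU _ _) _; rewrite leq_add2l.
    apply: leq_trans (leq_card_setU _ _) _.
    by apply: leq_add; apply: leq_trans (leq_imset_card _ _) _;
       rewrite cardsT card_ord.
  apply: leq_trans le1 (leq_trans le2 _).
  by rewrite addnC mul2n -addnn leq_add2l.
have outR : {in verts (rev_graph K), forall v, #|out_edges (rev_graph K) v| != 1}.
  by move=> v Gv; apply: outK.
suff : wp test_reduced (fun s => exists2 ok : bool, var s vOk = ok &
    (ok <-> forall r, r \in sources (rev_graph K) -> in_tree (rev_graph K) r) /\
    clk s <= 60 * (#|sources (rev_graph K)| * #|sinks (rev_graph K)|) + 700 * L)
      (HSt R0 (fun _ _ => 0) 0).
  case=> s E [ok eok [okP ck]]; exists ok; split=> //; last by exists s.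
  by rewrite okP; apply: iff_sym; apply: singly_connectedP clR rkR.
have [S SE] : exists S, S = #|sources (rev_graph K)| * #|sinks (rev_graph K)|.
  by eexists.
rewrite -SE.
apply: wp_seq; apply: wp_conseq (load_correct R0 _ i0 i1 ia ib) _ => s1 _ [st1 c1 z1].
apply: wp_seq; apply: wp_conseq (contract_correct st1 clG rkG uo1 so1) _.
move=> s2 [_ fa2] [st2 c2].
apply: wp_seq; apply: wp_conseq (swap_correct st2) _ => s3 [_ fa3] [st3 c3].
apply: wp_seq; apply: wp_conseq (contract_correct st3 cl1' rk1 uo2 so2) _.
move=> s4 [_ fa4] [st4 c4]; rewrite -/K in st4.
(* The stages so far do not write these arrays, which therefore still hold their initial zeros. *)
have z4 j : j \in [:: NSR; HED; MRK] -> arr s4 j = fun=> 0.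
  rewrite !inE => /or3P[] /eqP->.
  - by rewrite (fa4 NSR isT) (fa3 NSR isT) (fa2 NSR isT) z1.
  - by rewrite (fa4 HED isT) (fa3 HED isT) (fa2 HED isT) z1.
  - by rewrite (fa4 MRK isT) (fa3 MRK isT) (fa2 MRK isT) z1.
apply: wp_seq; apply: wp_conseq (build_correct (G := rev_graph K) _ _) _.
- by rewrite revK.
- by move=> v; rewrite !z4.
move=> s5 [fv5 fa5] [nsr5 [adj adjP] c5].
have [hd4 alv4 flg4 kv4] := st4.
have adjP' u : uniq (adj u) /\ adj u =i out_edges (rev_graph K) u.
  by have [] := adjP u.
apply: wp_conseq (search_correct clR outR adjP' _ _ nsr5 _) _.
- have [eN eM e1] := hd4; split.
  + by split; [rewrite (fv5 vN isT) | rewrite (fv5 vM isT) | rewrite (fv5 vOne isT)].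
  + by move=> e /kv4[_]; rewrite (fa5 VAL isT).
  + by move=> u; have [] := adjP u.
- by move=> v; rewrite (fa5 ALV isT) alv4.
- by move=> x; rewrite (fa5 MRK isT) z4.
move=> s6 _ [ok eok [okP c6]]; exists ok => //; split=> //.
by rewrite -SE in c6; lia.
Qed.

End Verification.

(** * Reading the encoding, and the final constants *)

Lemma size_flatten_pairs (T : Type) (f g : T -> nat) s :
  size (flatten [seq [:: f e; g e] | e <- s]) = (size s).*2.
Proof. by elim: s => //= e s ->. Qed.

Lemma nth_flatten_pairs (T : Type) (f g : T -> nat) s i x0 : i < size s ->
  nth 0 (flatten [seq [:: f e; g e] | e <- s]) (i + i) = f (nth x0 s i) /\
  nth 0 (flatten [seq [:: f e; g e] | e <- s]) (i + i).+1 = g (nth x0 s i).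
Proof.
elim: s i => // e s IHs [|i] //= lt_i.
by rewrite addnS; apply: IHs.
Qed.

Theorem theorem1 :
  exists (P : seq instr) (c C : nat),
  forall (n m : nat) (a b : 'I_m -> 'I_n),
    acyclic (input_graph a b) ->
    forall Gr : digraph 'I_n 'I_m,
      reduced (input_graph a b) Gr ->
      let s := #|sources Gr| in
      let t := #|sinks Gr| in
      exists ans : bool,
        outputs_within (word_length n m c) P (encode a b)
                       (C * maxn 1 (s * t + m)) ans /\
        (ans <-> singly_connected Gr).
Proof.
(* With 6 the word size gives [2 ^ w >= L ^ 6 >= 32 * L], as [L >= 2]. In [C], 20 is the compilation
   factor, 60 and 700 come from the program, 8 from prologue and epilogue, and 5 from [L <= 3 * m +
   s * t + 2 <= 5 * maxn 1 (s * t + m)]. *)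
exists (program test_reduced vOk), 6, (20 * (60 + 700 * 5) + 8).
move=> n m a b _ Gr red s t.
pose L := n + m + 2; set w := word_length n m 6.
have Lw : 20 * L <= 2 ^ w.
  have le_L : L <= 2 ^ up_log 2 L by apply: up_logP.
  have -> : 2 ^ w = (2 ^ up_log 2 L) ^ 6 by rewrite -expnM mulnC.
  apply: (@leq_trans (L ^ 6)); last by rewrite leq_exp2r.
  have L2 : 2 ^ 5 <= L ^ 5 by rewrite leq_exp2r // /L; lia.
  by rewrite expnSr leq_mul2r (leq_trans _ L2) ?orbT.
have i0 : nth 0 (encode a b) 0 = n by [].
have i1 : nth 0 (encode a b) 1 = m by [].
have ie (e : 'I_m) : nth 0 (encode a b) (e + e + 2) = a e /\
    nth 0 (encode a b) (e + e + 2 + 1) = b e.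
  rewrite addn2 addn1 /=.
  have := @nth_flatten_pairs _ (fun e => val (a e)) (fun e => val (b e))
    (enum 'I_m) e e.
  by rewrite size_enum_ord nth_ord_enum; apply.
have ia e := (ie e).1; have ib e := (ie e).2.
have sz : size (encode a b) <= L.*2.
  by rewrite /= size_flatten_pairs size_enum_ord /L; lia.
have H R0 := test_reduced_correct Lw R0 i0 i1 ia ib red.
have [ok [okP le_n _]] := H (fun=> 0).
exists ok; split=> //.
suff : outputs_within w (program test_reduced vOk) (encode a b)
    (20 * (60 * (s * t) + 700 * L) + 8) ok.
  case=> k [le_k hk rk]; exists k; split=> //; apply: leq_trans le_k _.
  move: le_n; rewrite -/s -/t /L.
  by move: (s * t) => st; lia.
apply: (program_correct i0 i1 sz Lw) => R0.
have [ok' [okP' _ wpR]] := H R0.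
(* The answer could a priori vary with the initial variables [R0]; both booleans decide single
   connectedness, so they agree. *)
have -> : ok = ok' :> nat.
  by congr nat_of_bool; apply/idP/idP => /[dup]; rewrite ?okP ?okP'.
apply: wp_conseq wpR _ => s' _ [-> ck]; split=> //.
by case: ok' {okP'}; rewrite /= ?expn_gt0 //; move: Lw; rewrite /L; lia.
Qed.
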